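(* Let $k$ be an algebraically closed field and let $\mathsf{D}^{\operatorname{c}}(k[X]/(X^2))$ be the compact derived category of the dual numbers. The stability manifold of $\mathsf{D}^{\operatorname{c}}(k[X]/(X^2))$ is the empty set, and the co-stability manifold $\operatorname{Costab}(\mathsf{D}^{\operatorname{c}}(k[X]/(X^2)))$ is homeomorphic to $\mathbb{C}$.
   Context: For a ring $A$, $\mathsf{D}^{\operatorname{c}}(A)$ is the full triangulated subcategory of compact objects in the derived category of $A$-modules (equivalently, perfect complexes). Let $\mathsf{T}$ be an essentially small triangulated category which is Krull-Schmidt (split idempotents, every object a finite direct sum of indecomposables, indecomposables have local endomorphism rings) with finitely generated $\operatorname{K}_0(\mathsf{T})$; $\Sigma$ is its suspension, $\mathsf{T}(-,-)=\operatorname{Hom}_{\mathsf{T}}(-,-)$, $\operatorname{ind}$ denotes the class of indecomposable objects, subcategories are closed under isomorphism. Stability manifold (Bridgeland). A slicing $\mathscr{P}$ in $\mathsf{T}$ is a collection of full additive subcategories $\mathscr{P}(\varphi)$, $\varphi\in\mathbb{R}$, such that $\mathscr{P}(\varphi+1)=\Sigma\mathscr{P}(\varphi)$; $\varphi_1>\varphi_2$ implies $\mathsf{T}(\mathscr{P}(\varphi_1),\mathscr{P}(\varphi_2))=0$; and each $t\neq0$ has a finite filtration $0\cong t_0\to t_1\to\cdots\to t_n\cong t$ with distinguished triangles $t_{i-1}\to t_i\to p_i\to \Sigma t_{i-1}$, $p_i\in\mathscr{P}(\varphi_i)$, $\varphi_1>\cdots>\varphi_n$. A stability condition is a pair $(Z,\mathscr{P})$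 with $Z:\operatorname{K}_0(\mathsf{T})\to\mathbb{C}$ a group homomorphism and $\mathscr{P}$ a slicing such that $Z(p)=m(p)\exp(i\pi\varphi)$ with $m(p)>0$ for $0\neq p\in\mathscr{P}(\varphi)$. It is locally-finite if there is $\eta>0$ such that for each $t\in\mathbb{R}$ the extension closure of $\bigcup_{\varphi\in]t-\eta,t+\eta[}\mathscr{P}(\varphi)$ is a quasi-abelian category of finite length (Artinian and Noetherian with respect to strict subobjects). The stability manifold is the set of locally-finite stability conditions on $\mathsf{T}$ (with Bridgeland's topology). Co-stability manifold. A co-slicing $\mathscr{Q}$ in $\mathsf{T}$ is a collection of full subcategories $\mathscr{Q}(\varphi)$, $\varphi\in\mathbb{R}$, each closed under (finite) direct sums and direct summands, such that: (i) $\mathscr{Q}(\varphi+1)=\Sigma\mathscr{Q}(\varphi)$; (ii) $\varphi_1<\varphi_2$ implies $\mathsf{T}(\mathscr{Q}(\varphi_1),\mathscr{Q}(\varphi_2))=0$; (iii) for each $t\neq0$ there are an integer $n\ge1$, morphisms $0\cong t_0\to t_1\to\cdots\to t_n\cong t$ and distinguished triangles $t_{i-1}\to t_i\to q_i\to\Sigma t_{i-1}$ with $q_i\in\mathscr{Q}(\varphi_i)$ and $\varphi_1<\cdots<\varphi_n$. It satisfies condition (S) if for each $\varphi$ and all $q_1,q_2\in\operatorname{ind}\mathscr{Q}(\varphi)$ with $q_1\not\cong q_2$ we have $\mathsf{T}(q_1,q_2)=0$. A co-stability condition on $\mathsf{T}$ is a pair $(Z,\mathscr{Q})$ with $Z:\operatorname{K}_0(\mathsf{T})\to\mathbb{C}$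 a group homomorphism and $\mathscr{Q}$ a co-slicing such that $Z(q)=m(q)\exp(i\pi\varphi)$ with $m(q)>0$ for each $0\neq q\in\mathscr{Q}(\varphi)$. For $I\subseteq\mathbb{R}$, $\mathscr{Q}(I)$ is the smallest full subcategory containing $\bigcup_{\varphi\in I}\mathscr{Q}(\varphi)$ and closed under extensions and direct summands. The function $d(\mathscr{Q},\mathscr{R})=\inf\{\varepsilon>0\mid\mathscr{Q}(\varphi)\subseteq\mathscr{R}([\varphi-\varepsilon,\varphi+\varepsilon])\text{ for each }\varphi\in\mathbb{R}\}$ is a metric on the set of co-slicings; $\operatorname{Coslice}(\mathsf{T})$ is the set of co-slicings satisfying (S) with this metric topology. The co-stability manifold $\operatorname{Costab}(\mathsf{T})$ is the set of co-stability conditions $(Z,\mathscr{Q})$ with $\mathscr{Q}\in\operatorname{Coslice}(\mathsf{T})$, with the subspace topology from $\operatorname{Hom}_{\mathbb{Z}}(\operatorname{K}_0(\mathsf{T}),\mathbb{C})\times\operatorname{Coslice}(\mathsf{T})$, where the first factor is a finite dimensional complex vector space with its usual topology. *)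

(* Defs.v *)
From HB Require Import structures.
From mathcomp Require Import all_boot all_order all_algebra.
From mathcomp Require Import qpoly ring_quotient.
From mathcomp Require Import all_classical all_reals all_analysis.
From mathcomp Require Import complex.
From mathcomp.multinomials Require Import freeg.
From mathcomp Require Import zify.

Set Implicit Arguments.
Unset Strict Implicit.
Unset Printing Implicit Defensive.

Import Order.TTheory GRing.Theory Num.Theory.
Import numFieldNormedType.Exports.

Local Open Scope classical_set_scope.
Local Open Scope ring_scope.

Reserved Notation "f ;; g" (at level 39, left associativity).

(******************************************************************************)
(* A preadditive category with an additive suspension endofunctor and a class *)
(* of distinguished triangles X -> Y -> Z -> susp X.  These are the data of a *)
(* triangulated category that the notions below depend on; the octahedral and *)
(* the other triangle axioms are not bundled.  Composition is diagrammatic:   *)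
(* f ;; g is "f, then g".                                                     *)
(******************************************************************************)

Record tricat := TriCat {
  obj :> Type;
  mor : obj -> obj -> zmodType;
  idm : forall X, mor X X;
  compm : forall X Y Z, mor X Y -> mor Y Z -> mor X Z;
  susp : obj -> obj;
  suspm : forall X Y, mor X Y -> mor (susp X) (susp Y);
  distinguished : forall X Y Z, mor X Y -> mor Y Z -> mor Z (susp X) -> Prop;
  comp1m : forall X Y (f : mor X Y), compm (idm X) f = f;
  compm1 : forall X Y (f : mor X Y), compm f (idm Y) = f;
  compA : forall X Y Z W (f : mor X Y) (g : mor Y Z) (h : mor Z W),
    compm f (compm g h) = compm (compm f g) h;
  compDl : forall X Y Z (f f' : mor X Y) (g : mor Y Z),
    compm (f + f') g = compm f g + compm f' g;
  compDr : forall X Y Z (f : mor X Y) (g g' : mor Y Z),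
    compm f (g + g') = compm f g + compm f g';
  suspm1 : forall X, suspm (idm X) = idm (susp X);
  suspmM : forall X Y Z (f : mor X Y) (g : mor Y Z),
    suspm (compm f g) = compm (suspm f) (suspm g);
  suspmD : forall X Y (f g : mor X Y), suspm (f + g) = suspm f + suspm g;
}.

Arguments idm {t} X.
Notation "f ;; g" := (compm f g).

Section Category.
Variable T : tricat.
Implicit Types (X Y Z : T) (S : set T).

Definition is_iso X Y (f : mor X Y) :=
  exists2 g : mor Y X, f ;; g = idm X & g ;; f = idm Y.

Definition isom X Y := exists f : mor X Y, is_iso f.

Definition is_zero X := idm X = 0.

Definition is_biprod X Y Z :=
  exists (i1 : mor X Z) (i2 : mor Y Z) (p1 : mor Z X) (p2 : mor Z Y),
    [/\ i1 ;; p1 = idm X, i2 ;; p2 = idm Y, i1 ;; p2 = 0, i2 ;; p1 = 0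
      & p1 ;; i1 + p2 ;; i2 = idm Z].

Definition indecomposable X :=
  ~ is_zero X /\ forall Y Z, is_biprod Y Z X -> is_zero Y \/ is_zero Z.

Definition is_distinguished X Y Z :=
  exists (f : mor X Y) (g : mor Y Z) (h : mor Z (susp X)), distinguished f g h.

(* Full subcategories are given by their class of objects. *)

Definition iso_closed S := forall X Y, isom X Y -> S X -> S Y.

(* The empty direct sum is included. *)
Definition sum_closed S :=
  (forall X, is_zero X -> S X) /\
  (forall X Y Z, is_biprod X Y Z -> S X -> S Y -> S Z).

Definition summand_closed S := forall X Y Z, is_biprod X Y Z -> S Z -> S X.

Definition ext_closed S :=
  forall X Y Z, is_distinguished X Y Z -> S X -> S Z -> S Y.

Definition susp_of S : set T := [set X | exists2 Y, S Y & isom X (susp Y)].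

Definition hom_vanish S1 S2 := forall X Y (f : mor X Y), S1 X -> S2 Y -> f = 0.

End Category.

Section QuasiAbelian.
Variables (T : tricat) (S : set T).

Definition is_mono (X Y : T) (f : mor X Y) :=
  forall W (g h : mor W X), S W -> g ;; f = h ;; f -> g = h.

Definition is_epi (X Y : T) (f : mor X Y) :=
  forall W (g h : mor Y W), S W -> f ;; g = f ;; h -> g = h.

Definition is_ker (X Y K : T) (f : mor X Y) (k : mor K X) :=
  [/\ S K, k ;; f = 0
    & forall W (g : mor W X), S W -> g ;; f = 0 ->
        exists! u : mor W K, u ;; k = g].

Definition is_coker (X Y C : T) (f : mor X Y) (c : mor Y C) :=
  [/\ S C, f ;; c = 0
    & forall W (g : mor Y W), S W -> f ;; g = 0 ->
        exists! u : mor C W, c ;; u = g].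

(* The canonical map u from the coimage J (the cokernel of the kernel) to the
   image I (the kernel of the cokernel) is an isomorphism. *)
Definition is_strict (X Y : T) (f : mor X Y) :=
  exists (K C I J : T) (k : mor K X) (c : mor Y C) (m : mor I Y) (e : mor X J)
    (u : mor J I),
    [/\ is_ker f k /\ is_coker f c, is_ker c m, is_coker k e,
        e ;; u ;; m = f & is_iso u].

Definition strict_mono (X Y : T) (f : mor X Y) := is_mono f /\ is_strict f.
Definition strict_epi (X Y : T) (f : mor X Y) := is_epi f /\ is_strict f.

Definition is_pullback (X Y Z P : T) (f : mor X Z) (g : mor Y Z)
    (p : mor P X) (q : mor P Y) :=
  [/\ S P, p ;; f = q ;; g
    & forall W (a : mor W X) (b : mor W Y), S W -> a ;; f = b ;; g ->
        exists! u : mor W P, u ;; p = a /\ u ;; q = b].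

Definition is_pushout (X Y Z P : T) (f : mor Z X) (g : mor Z Y)
    (p : mor X P) (q : mor Y P) :=
  [/\ S P, f ;; p = g ;; q
    & forall W (a : mor X W) (b : mor Y W), S W -> f ;; a = g ;; b ->
        exists! u : mor P W, p ;; u = a /\ q ;; u = b].

Definition quasi_abelian :=
  [/\ (exists2 X, S X & is_zero X) /\
        (forall X Y, S X -> S Y -> exists2 Z, S Z & is_biprod X Y Z),
      forall (X Y : T) (f : mor X Y), S X -> S Y ->
        (exists (K : T) (k : mor K X), is_ker f k) /\
        (exists (C : T) (c : mor Y C), is_coker f c),
      forall (X Y Z P : T) (f : mor X Z) (g : mor Y Z)
          (p : mor P X) (q : mor P Y), S X -> S Y -> S Z ->
        is_pullback f g p q -> strict_epi f -> strict_epi q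
    & forall (X Y Z P : T) (f : mor Z X) (g : mor Z Y)
          (p : mor X P) (q : mor Y P), S X -> S Y -> S Z ->
        is_pushout f g p q -> strict_mono f -> strict_mono q].

(* Chains of strict subobjects u n : E n -> X. *)

Definition artinian := forall (X : T) (E : nat -> T)
    (u : forall n, mor (E n) X) (v : forall n, mor (E n.+1) (E n)),
  S X -> (forall n, S (E n)) -> (forall n, strict_mono (u n)) ->
  (forall n, v n ;; u n = u n.+1) ->
  exists N, forall n, (N <= n)%N -> is_iso (v n).

Definition noetherian := forall (X : T) (E : nat -> T)
    (u : forall n, mor (E n) X) (v : forall n, mor (E n) (E n.+1)),
  S X -> (forall n, S (E n)) -> (forall n, strict_mono (u n)) ->
  (forall n, v n ;; u n.+1 = u n) ->
  exists N, forall n, (N <= n)%N -> is_iso (v n).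

Definition quasi_abelian_finite_length :=
  [/\ quasi_abelian, artinian & noetherian].

End QuasiAbelian.

(******************************************************************************)
(* The Grothendieck group: the free abelian group on the objects, modulo the  *)
(* subgroup generated by [Y] - [X] - [Z] for X -> Y -> Z -> susp X            *)
(* distinguished.                                                             *)
(******************************************************************************)

Section K0.
Variable T : tricat.

Definition free_ab : zmodType := {freeg {classic T} / int}.
Definition fgen (X : T) : free_ab := << X : {classic T} >>.

Definition K0_rel : set free_ab := smallest
  [set G : set free_ab | G 0 /\ forall x y, G x -> G y -> G (x - y)]
  [set w | exists X Y Z,
    is_distinguished X Y Z /\ w = fgen Y - fgen X - fgen Z].

Definition K0_relb : {pred free_ab} := fun x => `[< K0_rel x >].

Fact K0_rel_zmod_closed : zmod_closed K0_relb.
Proof.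
split; first by apply/asboolP => G [[]].
move=> x y /asboolP Gx /asboolP Gy; apply/asboolP => G hG.
by have [[_ B] _] := hG; apply: B; [exact: Gx | exact: Gy].
Qed.

HB.instance Definition _ :=
  GRing.isZmodClosed.Build free_ab K0_relb K0_rel_zmod_closed.

Definition K0 : zmodType := @Quotient.quot free_ab K0_relb.
Definition K0_class (X : T) : K0 := (\pi_K0 (fgen X))%qT.

End K0.

(******************************************************************************)
(* Slicings and co-slicings.                                                  *)
(******************************************************************************)

Section Slicings.
Variables (R : realType) (T : tricat).
Implicit Types (P Q : R -> set T) (phi : R) (X : T) (S : set T).

(* A finite filtration 0 = E 0 -> E 1 -> ... -> E n = X whose i-th factor F i
   lies in P (phi i), the phases phi i being increasing for the relation lt. *)
Definition has_filtration (lt : R -> R -> Prop) P X :=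
  exists (n : nat) (E F : nat -> T) (phi : nat -> R),
    [/\ (0 < n)%N, is_zero (E 0%N) /\ isom (E n) X,
        forall i, (i < n)%N -> is_distinguished (E i) (E i.+1) (F i),
        forall i, (i < n)%N -> P (phi i) (F i)
      & forall i j, (i < j < n)%N -> lt (phi i) (phi j)].

Definition is_slicing P :=
  [/\ forall phi, iso_closed (P phi) /\ sum_closed (P phi),
      forall phi, P (phi + 1) = susp_of (P phi),
      forall phi1 phi2, phi1 > phi2 -> hom_vanish (P phi1) (P phi2)
    & forall X, ~ is_zero X -> has_filtration (fun a b => a > b) P X].

Definition is_coslicing Q :=
  [/\ forall phi, sum_closed (Q phi) /\ summand_closed (Q phi),
      forall phi, Q (phi + 1) = susp_of (Q phi),
      forall phi1 phi2, phi1 < phi2 -> hom_vanish (Q phi1) (Q phi2)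
    & forall X, ~ is_zero X -> has_filtration (fun a b => a < b) Q X].

Definition condition_S Q := forall phi X Y, indecomposable X ->
  indecomposable Y -> Q phi X -> Q phi Y -> ~ isom X Y ->
  forall f : mor X Y, f = 0.

Definition ext_closure S : set T :=
  smallest [set U | iso_closed U /\ ext_closed U] S.

Definition coslice_hull Q (I : set R) : set T :=
  smallest [set U | ext_closed U /\ summand_closed U]
    (\bigcup_(phi in I) Q phi).

(* Extended-real valued, so that the infimum of the empty set is +oo. *)
Definition coslice_dist Q Q' : \bar R :=
  ereal_inf [set e%:E | e in [set e : R | 0 < e /\
    forall phi, Q phi `<=` coslice_hull Q' `[phi - e, phi + e]%classic]].

Record coslice := Coslice {
  coslice_val :> R -> set T;
  coslice_is_coslicing : is_coslicing coslice_val;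
  coslice_condition_S : condition_S coslice_val }.

HB.instance Definition _ := gen_eqMixin coslice.
HB.instance Definition _ := gen_choiceMixin coslice.

Definition coslice_open : set_system coslice :=
  [set U | forall Q : coslice, U Q -> exists2 e : R, 0 < e &
    forall Q' : coslice, (coslice_dist Q Q' < e%:E)%E -> U Q'].

Fact coslice_openT : coslice_open setT.
Proof. by move=> Q _; exists 1. Qed.

Fact coslice_openI : setI_closed coslice_open.
Proof.
move=> U V oU oV Q [UQ VQ].
have [e e0 He] := oU _ UQ; have [d d0 Hd] := oV _ VQ.
exists (Num.min e d); first by rewrite lt_min e0.
move=> Q' lt; split; [apply: He|apply: Hd]; apply: (lt_le_trans lt);
  by rewrite lee_fin ge_min lexx ?orbT.
Qed.

Fact coslice_open_bigU (I : Type) (U : I -> set coslice) :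
  (forall i, coslice_open (U i)) -> coslice_open (\bigcup_i U i).
Proof.
move=> oU Q [i _ UiQ]; have [e e0 He] := oU i _ UiQ.
by exists e => // Q' /He; exists i.
Qed.

HB.instance Definition _ := isOpenTopological.Build coslice
  coslice_openT coslice_openI coslice_open_bigU.

End Slicings.

(******************************************************************************)
(* Stability and co-stability conditions.                                     *)
(******************************************************************************)

Section Manifolds.
Variables (R : realType) (T : tricat).
Local Notation C := R[i]^o.

(* Since K0 T is finitely generated in the cases of interest, the topology of
   the finite dimensional complex vector space Hom(K0 T, C) is that of
   pointwise convergence. *)
Definition central_charge := {additive K0 T -> C}.
Definition charge_fun (Z : central_charge) : {ptws K0 T -> C} := Z.

HB.instance Definition _ := gen_eqMixin central_charge.
HB.instance Definition _ := gen_choiceMixin central_charge.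
HB.instance Definition _ :=
  Topological.copy central_charge (initial_topology charge_fun).

Definition phase_ray (phi : R) : set C :=
  [set z | exists2 m : R, 0 < m &
    z = Complex (m * cos (pi * phi)) (m * sin (pi * phi))].

Definition compatible (Z : central_charge) (P : R -> set T) :=
  forall phi X, P phi X -> ~ is_zero X -> phase_ray phi (Z (K0_class X)).

Definition locally_finite_slicing (P : R -> set T) :=
  exists2 eta : R, 0 < eta & forall t : R, quasi_abelian_finite_length
    (ext_closure (\bigcup_(phi in `]t - eta, t + eta[%classic) P phi)).

Definition Stab : set (central_charge * (R -> set T)) :=
  [set s | [/\ is_slicing s.2, compatible s.1 s.2
    & locally_finite_slicing s.2]].

Definition Costab : set (central_charge * coslice R T) :=
  [set s : central_charge * coslice R T | compatible s.1 s.2].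

End Manifolds.

Arguments Stab : clear implicits.
Arguments Costab : clear implicits.

Definition homeomorphic (X Y : topologicalType) :=
  exists (f : X -> Y) (g : Y -> X),
    [/\ continuous f, continuous g, cancel f g & cancel g f].

(******************************************************************************)
(* Perfect complexes over a ring A.  In the derived category of A-modules the *)
(* compact objects are the perfect complexes, and between bounded complexes   *)
(* of finitely generated projectives every morphism is a homotopy class of    *)
(* chain maps; so the compact derived category of A is the bounded homotopy   *)
(* category of finitely generated projective left A-modules, in cohomological *)
(* grading.  A finitely generated projective module is encoded by an          *)
(* idempotent e : 'M[A]_n and stands for the summand {v | v *m e = v} of the  *)
(* row space A^n; maps from e to f are matrices h with e h = h = h f, acting  *)
(* by right multiplication.                                                   *)
(******************************************************************************)

Section Perfect.
Variable A : pzRingType.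

Record pcomplex := PComplex {
  rk : int -> nat;
  pr : forall i, 'M[A]_(rk i);
  df : forall i, 'M[A]_(rk i, rk (i + 1));
  prK : forall i, pr i *m pr i = pr i;
  prdf : forall i, pr i *m df i = df i;
  dfpr : forall i, df i *m pr (i + 1) = df i;
  dfdf : forall i, df i *m df (i + 1) = 0;
  pcbounded : exists N : nat, forall i, (N < `|i|)%N -> pr i = 0 }.

Section Maps.
Variables X Y : pcomplex.

Definition gmap := forall i, 'M[A]_(rk X i, rk Y i).

HB.instance Definition _ := Choice.on gmap.

Definition gmap0 : gmap := fun i => 0.
Definition gmapN (f : gmap) : gmap := fun i => - f i.
Definition gmapD (f g : gmap) : gmap := fun i => f i + g i.

Fact gmapDA : associative gmapD.
Proof.
by move=> f g h; apply: functional_extensionality_dep => i; exact: addrA. Qed.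
Fact gmapDC : commutative gmapD.
Proof.
by move=> f g; apply: functional_extensionality_dep => i; exact: addrC. Qed.
Fact gmap0D : left_id gmap0 gmapD.
Proof.
by move=> f; apply: functional_extensionality_dep => i; exact: add0r. Qed.
Fact gmapND : left_inverse gmap0 gmapN gmapD.
Proof.
by move=> f; apply: functional_extensionality_dep => i; exact: addNr. Qed.

HB.instance Definition _ := GRing.isZmodule.Build gmap
  gmapDA gmapDC gmap0D gmapND.

Definition is_cmap (f : gmap) := forall i,
  [/\ pr X i *m f i = f i, f i *m pr Y i = f i
    & f i *m df Y i = df X i *m f (i + 1)].

Definition is_cmapb : {pred gmap} := fun f => `[< is_cmap f >].

Fact is_cmap_zmod_closed : zmod_closed is_cmapb.
Proof.
split; first by apply/asboolP => i; split; rewrite ?mulmx0 ?mul0mx.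
move=> f g /asboolP hf /asboolP hg; apply/asboolP => i.
have [f1 f2 f3] := hf i; have [g1 g2 g3] := hg i.
have E j : (f - g) j = f j - g j by [].
by rewrite !E !mulmxBr !mulmxBl; split; congr (_ - _).
Qed.

HB.instance Definition _ :=
  GRing.isZmodClosed.Build gmap is_cmapb is_cmap_zmod_closed.

Record cmap := CMap { cmap_val : gmap; cmapP : cmap_val \in is_cmapb }.
Definition cmap_fun (f : cmap) i : 'M[A]_(rk X i, rk Y i) := cmap_val f i.
Coercion cmap_fun : cmap >-> Funclass.

HB.instance Definition _ := [isSub for cmap_val].
HB.instance Definition _ := [Choice of cmap by <:].
HB.instance Definition _ := [SubChoice_isSubZmodule of cmap by <:].

(* In degree i + 1 the homotopy is h i : X^(i+1) -> Y^i; this covers every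
   degree. *)
Definition nullhomotopic (f : cmap) :=
  exists h : forall i : int, 'M[A]_(rk X (i + 1), rk Y i),
    (forall i : int, pr X (i + 1) *m h i = h i /\ h i *m pr Y i = h i) /\
    (forall i : int, f (i + 1) = df X (i + 1) *m h (i + 1) + h i *m df Y i).

Definition nullhomotopicb : {pred cmap} := fun f => `[< nullhomotopic f >].

Fact nullhomotopic_zmod_closed : zmod_closed nullhomotopicb.
Proof.
split.
  apply/asboolP; exists (fun i => 0); split=> i; first by rewrite mulmx0 mul0mx.
  by rewrite mulmx0 mul0mx addr0.
move=> f g /asboolP[h [hp hd]] /asboolP[k [kp kd]]; apply/asboolP.
exists (fun i => h i - k i); split=> i.
  have [a b] := hp i; have [c d] := kp i.
  by rewrite mulmxBr mulmxBl a b c d.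
have -> : (f - g) (i + 1) = f (i + 1) - g (i + 1) by [].
by rewrite hd kd mulmxBr mulmxBl opprD addrACA.
Qed.

HB.instance Definition _ :=
  GRing.isZmodClosed.Build cmap nullhomotopicb nullhomotopic_zmod_closed.

Definition khom : zmodType := @Quotient.quot cmap nullhomotopicb.
Definition kclass (f : cmap) : khom := (\pi_khom f)%qT.

Lemma kclassP (f g : cmap) : kclass f = kclass g <-> nullhomotopic (f - g).
Proof.
have <- := asboolE (nullhomotopic (f - g)).
have -> : `[< nullhomotopic (f - g) >] = (f - g \in nullhomotopicb) by [].
by rewrite Quotient.idealrBE; split=> /eqP.
Qed.

Lemma kclassD : {morph kclass : f g / f + g}.
Proof. exact: (@raddfD _ _ (\pi_khom)%qT). Qed.

Lemma kreprK (a : khom) : kclass (repr a) = a.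
Proof. exact: reprK. Qed.

Lemma cmapE (f : cmap) i : [/\ pr X i *m f i = f i, f i *m pr Y i = f i
  & f i *m df Y i = df X i *m f (i + 1)].
Proof. by have /asboolP /(_ i) := cmapP f. Qed.

Lemma cmap_inj (f g : cmap) : (forall i, f i = g i) -> f = g.
Proof.
by move=> fg; apply/val_inj/functional_extensionality_dep => i; exact: fg.
Qed.

Definition mk_cmap (f : gmap) (hf : is_cmap f) : cmap := CMap (asboolT hf).

End Maps.

Lemma cmap_id_subproof X : is_cmap (X := X) (Y := X) (pr X).
Proof. by move=> i; rewrite prK prdf dfpr. Qed.

Definition cmap_id X : cmap X X := mk_cmap (@cmap_id_subproof X).

Lemma cmap_comp_subproof X Y Z (f : cmap X Y) (g : cmap Y Z) :
  is_cmap (X := X) (Y := Z) (fun i => f i *m g i).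
Proof.
move=> i; have [f1 f2 f3] := cmapE f i; have [g1 g2 g3] := cmapE g i.
by rewrite mulmxA f1 -!mulmxA g2 g3 mulmxA f3 mulmxA.
Qed.

Definition cmap_comp X Y Z (f : cmap X Y) (g : cmap Y Z) : cmap X Z :=
  mk_cmap (cmap_comp_subproof f g).

Lemma nullhomotopic_compl X Y Z (f : cmap X Y) (g : cmap Y Z) :
  nullhomotopic f -> nullhomotopic (cmap_comp f g).
Proof.
move=> [h [hp hd]]; exists (fun i => h i *m g i); split=> i.
  have [a b] := hp i; have [_ g2 _] := cmapE g i.
  by rewrite mulmxA a -mulmxA g2.
have [_ _ g3] := cmapE g i.
have -> : cmap_comp f g (i + 1) = f (i + 1) *m g (i + 1) by [].
by rewrite hd mulmxDl -!mulmxA g3.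
Qed.

Lemma nullhomotopic_compr X Y Z (f : cmap X Y) (g : cmap Y Z) :
  nullhomotopic g -> nullhomotopic (cmap_comp f g).
Proof.
move=> [h [hp hd]]; exists (fun i => f (i + 1) *m h i); split=> i.
  have [a b] := hp i; have [f1 _ _] := cmapE f (i + 1).
  by rewrite mulmxA f1 -mulmxA b.
have [_ _ f3] := cmapE f (i + 1).
have -> : cmap_comp f g (i + 1) = f (i + 1) *m g (i + 1) by [].
by rewrite hd mulmxDr !mulmxA f3.
Qed.

Definition kcomp X Y Z (a : khom X Y) (b : khom Y Z) : khom X Z :=
  kclass (cmap_comp (repr a) (repr b)).

Lemma kcompE X Y Z (f : cmap X Y) (g : cmap Y Z) :
  kcomp (kclass f) (kclass g) = kclass (cmap_comp f g).
Proof.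
apply/kclassP; set f' := repr _; set g' := repr _.
have hf : nullhomotopic (f' - f) by apply/kclassP; rewrite kreprK.
have hg : nullhomotopic (g' - g) by apply/kclassP; rewrite kreprK.
have -> : cmap_comp f' g' - cmap_comp f g =
    cmap_comp (f' - f) g' + cmap_comp f (g' - g).
  apply: cmap_inj => i.
  change (f' i *m g' i - f i *m g i =
    (f' i - f i) *m g' i + f i *m (g' i - g i)).
  by rewrite mulmxBl mulmxBr addrA subrK.
have /asboolP hl := nullhomotopic_compl g' hf.
have /asboolP hr := nullhomotopic_compr f hg.
apply/asboolP.
by apply: (@rpredD _ (@nullhomotopicb X Z)).
Qed.

Lemma khom_ind X Y (P : khom X Y -> Prop) :
  (forall f, P (kclass f)) -> forall a, P a.
Proof. by move=> H a; rewrite -[a]kreprK. Qed.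

Definition kid X : khom X X := kclass (cmap_id X).

Fact kcomp1m X Y (a : khom X Y) : kcomp (kid X) a = a.
Proof.
elim/khom_ind: a => f; rewrite kcompE; congr kclass; apply: cmap_inj => i.
by have [] := cmapE f i.
Qed.

Fact kcompm1 X Y (a : khom X Y) : kcomp a (kid Y) = a.
Proof.
elim/khom_ind: a => f; rewrite kcompE; congr kclass; apply: cmap_inj => i.
by have [] := cmapE f i.
Qed.

Fact kcompA X Y Z W (a : khom X Y) (b : khom Y Z) (c : khom Z W) :
  kcomp a (kcomp b c) = kcomp (kcomp a b) c.
Proof.
elim/khom_ind: a => f; elim/khom_ind: b => g; elim/khom_ind: c => h.
rewrite !kcompE; congr kclass; apply: cmap_inj => i; exact: mulmxA.
Qed.

Fact kcompDl X Y Z (a a' : khom X Y) (b : khom Y Z) :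
  kcomp (a + a') b = kcomp a b + kcomp a' b.
Proof.
elim/khom_ind: a => f; elim/khom_ind: a' => f'; elim/khom_ind: b => g.
rewrite -kclassD !kcompE -kclassD; congr kclass; apply: cmap_inj => i.
exact: mulmxDl.
Qed.

Fact kcompDr X Y Z (a : khom X Y) (b b' : khom Y Z) :
  kcomp a (b + b') = kcomp a b + kcomp a b'.
Proof.
elim/khom_ind: a => f; elim/khom_ind: b => g; elim/khom_ind: b' => g'.
rewrite -kclassD !kcompE -kclassD; congr kclass; apply: cmap_inj => i.
exact: mulmxDr.
Qed.

Fact shift_df_pr X i : - df X (i + 1) *m pr X (i + 1 + 1) = - df X (i + 1).
Proof. by rewrite mulNmx dfpr. Qed.
Fact shift_pr_df X i : pr X (i + 1) *m - df X (i + 1) = - df X (i + 1).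
Proof. by rewrite mulmxN prdf. Qed.
Fact shift_df_df X i : - df X (i + 1) *m - df X (i + 1 + 1) = 0.
Proof. by rewrite mulNmx mulmxN dfdf !oppr0. Qed.
Fact shift_bounded X :
  exists N : nat, forall i, (N < `|i|)%N -> pr X (i + 1) = 0.
Proof.
have [N HN] := pcbounded X; exists N.+1 => i Ni; apply: HN.
by move: Ni; lia.
Qed.

(* (cshift X)^i = X^(i+1), with differential -d. *)
Definition cshift X : pcomplex := @PComplex (fun i => rk X (i + 1))
  (fun i => pr X (i + 1)) (fun i => - df X (i + 1)) (fun i => prK X (i + 1))
  (shift_pr_df X) (shift_df_pr X) (shift_df_df X) (shift_bounded X).

Fact cmap_shift_subproof X Y (f : cmap X Y) :
  is_cmap (X := cshift X) (Y := cshift Y) (fun i => f (i + 1)).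
Proof.
move=> i; have [f1 f2 f3] := cmapE f (i + 1); split=> //=.
by rewrite mulmxN mulNmx f3.
Qed.

Definition cmap_shift X Y (f : cmap X Y) : cmap (cshift X) (cshift Y) :=
  mk_cmap (cmap_shift_subproof f).

Definition kshift X Y (a : khom X Y) : khom (cshift X) (cshift Y) :=
  kclass (cmap_shift (repr a)).

Lemma kshiftE X Y (f : cmap X Y) : kshift (kclass f) = kclass (cmap_shift f).
Proof.
apply/kclassP; set f' := repr _.
have [h [hp hd]] : nullhomotopic (f' - f) by apply/kclassP; rewrite kreprK.
exists (fun i => - h (i + 1)); split=> i.
  by have [a b] := hp (i + 1); rewrite mulmxN mulNmx a b.
have -> : (cmap_shift f' - cmap_shift f) (i + 1) = (f' - f) (i + 1 + 1) by [].
rewrite hd /=.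
by rewrite !mulmxN !mulNmx !opprK.
Qed.

Fact kshift1 X : kshift (kid X) = kid (cshift X).
Proof. by rewrite kshiftE; congr kclass; apply: cmap_inj. Qed.

Fact kshiftM X Y Z (a : khom X Y) (b : khom Y Z) :
  kshift (kcomp a b) = kcomp (kshift a) (kshift b).
Proof.
elim/khom_ind: a => f; elim/khom_ind: b => g.
by rewrite kcompE !kshiftE kcompE; congr kclass; apply: cmap_inj.
Qed.

Fact kshiftD X Y (a b : khom X Y) : kshift (a + b) = kshift a + kshift b.
Proof.
elim/khom_ind: a => f; elim/khom_ind: b => g.
by rewrite -kclassD !kshiftE -kclassD; congr kclass; apply: cmap_inj.
Qed.

(* The mapping cone: X^(i+1) (+) Y^i with differential
   (x, y) |-> (- dx, f x + dy). *)
Section Cone.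
Variables (X Y : pcomplex) (f : cmap X Y).

Definition cone_rk i := (rk X (i + 1) + rk Y i)%N.
Definition cone_pr i : 'M[A]_(cone_rk i) :=
  block_mx (pr X (i + 1)) 0 0 (pr Y i).
Definition cone_df i : 'M[A]_(cone_rk i, cone_rk (i + 1)) :=
  block_mx (- df X (i + 1)) (f (i + 1)) 0 (df Y i).

Fact cone_prK i : cone_pr i *m cone_pr i = cone_pr i.
Proof. by rewrite mulmx_block !prK !mul0mx !mulmx0 !addr0 add0r. Qed.

Fact cone_prdf i : cone_pr i *m cone_df i = cone_df i.
Proof.
have [f1 _ _] := cmapE f (i + 1).
by rewrite mulmx_block !mulmxN !prdf !mul0mx !mulmx0 f1 ?oppr0 !addr0 !add0r.
Qed.

Fact cone_dfpr i : cone_df i *m cone_pr (i + 1) = cone_df i.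
Proof.
have [_ f2 _] := cmapE f (i + 1).
by rewrite mulmx_block !mulNmx !dfpr !mul0mx !mulmx0 f2 ?oppr0 !addr0 !add0r.
Qed.

Fact cone_dfdf i : cone_df i *m cone_df (i + 1) = 0.
Proof.
have [_ _ f3] := cmapE f (i + 1).
rewrite mulmx_block !mulNmx !mulmxN !dfdf !mul0mx !mulmx0 f3.
by rewrite addNr !addr0 !oppr0 block_mx0.
Qed.

Fact cone_bounded : exists N : nat, forall i, (N < `|i|)%N -> cone_pr i = 0.
Proof.
have [N HN] := shift_bounded X; have [M HM] := pcbounded Y.
exists (maxn N M) => i; rewrite gtn_max => /andP[Ni Mi].
by rewrite /cone_pr HN // HM // block_mx0.
Qed.

Definition mcone : pcomplex := PComplex cone_prK cone_prdf cone_dfpr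
  cone_dfdf cone_bounded.

Fact cone_in_subproof :
  is_cmap (X := Y) (Y := mcone) (fun i => row_mx 0 (pr Y i)).
Proof.
move=> i; split=> /=; first by rewrite mul_mx_row mulmx0 prK.
  by rewrite mul_row_block !mul0mx !mulmx0 !addr0 !add0r prK.
rewrite mul_row_block !mul0mx !mulmx0 !addr0 !add0r prdf.
by rewrite mul_mx_row mulmx0 dfpr.
Qed.

Definition mcone_in : cmap Y mcone := mk_cmap cone_in_subproof.

Fact cone_out_subproof :
  is_cmap (X := mcone) (Y := cshift X) (fun i => col_mx (pr X (i + 1)) 0).
Proof.
move=> i; split=> /=.
- by rewrite mul_block_col !mul0mx !mulmx0 !addr0 prK.
- by rewrite mul_col_mx mul0mx prK.
rewrite mul_col_mx mul0mx mul_block_col !mul0mx !mulmx0 !addr0.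
by rewrite mulmxN prdf mulNmx dfpr.
Qed.

Definition mcone_out : cmap mcone (cshift X) := mk_cmap cone_out_subproof.

End Cone.

Definition kiso X Y (a : khom X Y) :=
  exists2 b : khom Y X, kcomp a b = kid X & kcomp b a = kid Y.

(* Distinguished: isomorphic to X' -> Y' -> mcone u -> cshift X' for some u. *)
Definition kdist X Y Z (f : khom X Y) (g : khom Y Z) (h : khom Z (cshift X)) :=
  exists (X' Y' : pcomplex) (u : cmap X' Y')
    (a : khom X X') (b : khom Y Y') (c : khom Z (mcone u)),
    [/\ [/\ kiso a, kiso b & kiso c],
        kcomp f b = kcomp a (kclass u),
        kcomp g c = kcomp b (kclass (mcone_in u))
      & kcomp h (kshift a) = kcomp c (kclass (mcone_out u))].

Definition Dperf : tricat := @TriCat pcomplex khom kid kcomp cshift kshift kdist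
  kcomp1m kcompm1 kcompA kcompDl kcompDr kshift1 kshiftM kshiftD.

End Perfect.

(* {poly %/ p} quotients by p itself only when p is monic of positive degree. *)
Lemma mk_monic_X2 (k : fieldType) : mk_monic ('X^2 : {poly k}) = 'X^2.
Proof. by rewrite /mk_monic size_polyXn monicXn. Qed.

Definition dual_numbers (k : fieldType) : comNzRingType :=
  {poly %/ ('X^2 : {poly k})}.

(* Main.v *)
(* Every perfect complex over the dual numbers A is homotopy equivalent to a
   minimal one, whose differential vanishes modulo the generator eps of the
   maximal ideal.  If the nonzero terms of a minimal complex X range from degree
   a to degree b, a map X^a -> X^b that is nonzero modulo eps is a chain map
   X -> Sigma^(b-a) X that is not null-homotopic, and eps times a map X^b -> X^a
   gives in the same way a nonzero map Sigma^(b-a) X -> X.  An object of Q(phi)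
   has no nonzero maps to its positive suspensions if Q is a co-slicing, and an
   object of P(phi) receives none from them if P is a slicing; in both cases it is
   therefore concentrated in a single degree, i.e. a sum of copies of one
   Sigma^j A.

   For a slicing, this makes the first nonzero factor of a filtration of the
   complex A --eps--> A contribute a direct summand Sigma^j A of that complex,
   which has none.  For a co-slicing, it leaves only Q(b + j) = add(Sigma^j A)
   for a unique real b; the metric on co-slicings becomes the distance between
   the parameters b, and Z is determined by Z(A) = m exp(i pi b), because K_0 is
   generated by the class of A.  The homeomorphism is (Z, Q) |-> ln m + i b.  That
   Z(A) can be arbitrary is the Euler characteristic on K_0, computed from the
   ranks of the reduced terms. *)

From HB Require Import structures.
From mathcomp Require Import all_boot all_order all_algebra.
From mathcomp Require Import qpoly ring_quotient.
From mathcomp Require Import all_classical all_reals all_analysis.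
From mathcomp Require Import complex.
From mathcomp.multinomials Require Import freeg.
From mathcomp Require Import zify.
Require Import Defs.

Set Implicit Arguments.
Unset Strict Implicit.
Unset Printing Implicit Defensive.

Import Order.TTheory GRing.Theory Num.Theory.
Import numFieldNormedType.Exports.

Local Open Scope classical_set_scope.
Local Open Scope ring_scope.

(** * Additive categories *)

Section AdditiveCategory.
Variable T : tricat.
Implicit Types (X Y Z W : T) (S : set T).

Lemma comp0m X Y Z (g : mor Y Z) : (0 : mor X Y) ;; g = 0.
Proof. by apply: (addrI ((0 : mor X Y) ;; g)); rewrite -compDl !addr0. Qed.

Lemma compm0 X Y Z (f : mor X Y) : f ;; (0 : mor Y Z) = 0.
Proof. by apply: (addrI (f ;; (0 : mor Y Z))); rewrite -compDr !addr0. Qed.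

Lemma suspm0 X Y : suspm (0 : mor X Y) = 0.
Proof. by apply: (addrI (suspm (0 : mor X Y))); rewrite -suspmD !addr0. Qed.

Lemma zero_source X Y (f : mor X Y) : is_zero X -> f = 0.
Proof. by move=> X0; rewrite -(comp1m f) X0 comp0m. Qed.

Lemma zero_target X Y (f : mor X Y) : is_zero Y -> f = 0.
Proof. by move=> Y0; rewrite -(compm1 f) Y0 compm0. Qed.

Lemma susp_zero X : is_zero X -> is_zero (susp X).
Proof. by rewrite /is_zero -suspm1 => ->; rewrite suspm0. Qed.

Lemma isom_refl X : isom X X.
Proof. by exists (idm X), (idm X); rewrite comp1m. Qed.

Lemma isom_sym X Y : isom X Y -> isom Y X.
Proof. by move=> [f [g fg gf]]; exists g, f. Qed.

Lemma is_iso_comp X Y Z (f : mor X Y) (g : mor Y Z) :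
  is_iso f -> is_iso g -> is_iso (f ;; g).
Proof.
move=> [f' ff' f'f] [g' gg' g'g]; exists (g' ;; f').
  by rewrite -compA (compA g) gg' comp1m.
by rewrite -compA (compA f') f'f comp1m.
Qed.

Lemma isom_trans X Y Z : isom X Y -> isom Y Z -> isom X Z.
Proof. by move=> [f hf] [g hg]; exists (f ;; g); apply: is_iso_comp. Qed.

Lemma isom_zero X Y : isom X Y -> is_zero X -> is_zero Y.
Proof. by move=> [f [g fg gf]] X0; rewrite /is_zero -gf (zero_target g X0) comp0m. Qed.

Lemma zero_isom X Y : is_zero X -> is_zero Y -> isom X Y.
Proof. by move=> X0 Y0; exists 0, 0; rewrite comp0m ?X0 ?Y0. Qed.

Lemma isom_susp X Y : isom X Y -> isom (susp X) (susp Y).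
Proof.
by move=> [f [g fg gf]]; exists (suspm f), (suspm g); rewrite -suspmM ?fg ?gf suspm1.
Qed.

Lemma biprod_isom X Y Z X' : is_biprod X Y Z -> isom X X' -> is_biprod X' Y Z.
Proof.
move=> [i1 [i2 [p1 [p2 [h1 h2 h3 h4 h5]]]]] [f [g fg gf]].
exists (g ;; i1), i2, (p1 ;; f), p2; split=> //.
- by rewrite -compA (compA i1) h1 comp1m gf.
- by rewrite -compA h3 compm0.
- by rewrite compA h4 comp0m.
- by rewrite -compA (compA f) fg comp1m.
Qed.

Lemma biprod_isom_total X Y Z Z' :
  is_biprod X Y Z -> isom Z Z' -> is_biprod X Y Z'.
Proof.
move=> [i1 [i2 [p1 [p2 [h1 h2 h3 h4 h5]]]]] [f [g fg gf]].
have K U V (i : mor U Z) (p : mor Z V) : i ;; f ;; (g ;; p) = i ;; p.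
  by rewrite -compA (compA f) fg comp1m.
exists (i1 ;; f), (i2 ;; f), (g ;; p1), (g ;; p2); rewrite !K; split=> //.
by rewrite -!compA -compDr (compA p1) (compA p2) -compDl h5 comp1m.
Qed.

Lemma biprod0 X Y : is_zero Y -> is_biprod X Y X.
Proof.
move=> Y0; exists (idm X), 0, (idm X), 0.
by split; rewrite ?comp1m ?compm0 ?comp0m ?Y0 ?addr0.
Qed.

Lemma biprod_zero_isom X Y Z : is_biprod X Y Z -> is_zero Y -> isom X Z.
Proof.
move=> [i1 [i2 [p1 [p2 [h1 h2 h3 h4 h5]]]]] Y0; exists i1, p1 => //.
by rewrite -h5 (zero_target p2 Y0) comp0m addr0.
Qed.

(** An object isomorphic to [X] is a biproduct of [X] with a zero object. Co-slicings are only
    assumed closed under sums and summands, and this makes them closed under isomorphism. *)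
Lemma sum_closed_iso S : (exists Z : T, is_zero Z) -> sum_closed S -> iso_closed S.
Proof.
move=> [Z Z0] [S0 SD] X Y XY SX.
by apply: (SD X Z Y) => //; [apply: biprod_isom_total XY; apply: biprod0|apply: S0].
Qed.

Definition retract X Y := exists (s : mor X Y) (r : mor Y X), s ;; r = idm X.

Lemma biprod_retract X Y Z : is_biprod X Y Z -> retract X Z.
Proof. by move=> [i1 [i2 [p1 [p2 [h1 _ _ _ _]]]]]; exists i1, p1. Qed.

Lemma isom_retract X Y Z : isom Y Z -> retract X Y -> retract X Z.
Proof.
move=> [f [g fg gf]] [s [r sr]]; exists (s ;; f), (g ;; r).
by rewrite -compA (compA f) fg comp1m.
Qed.

Lemma retract_isom X X' Y : isom X X' -> retract X Y -> retract X' Y.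
Proof.
move=> [f [g fg gf]] [s [r sr]]; exists (g ;; s), (r ;; f).
by rewrite -compA (compA s) sr comp1m.
Qed.

Lemma retract_susp X Y : retract X Y -> retract (susp X) (susp Y).
Proof.
by move=> [s [r sr]]; exists (suspm s), (suspm r); rewrite -suspmM sr suspm1.
Qed.

(** The identity of [W] factors as [W -> X -> W -> Y -> W], and the part [X -> W -> Y] is zero. *)
Lemma retract_hom_vanish S1 S2 X Y W : hom_vanish S1 S2 -> S1 X -> S2 Y ->
  retract W X -> retract W Y -> is_zero W.
Proof.
move=> S12 SX SY [s [r sr]] [s' [r' sr']].
rewrite /is_zero -(comp1m (idm W)) -{1}sr -sr' compA -(compA s).
by rewrite (S12 _ _ (r ;; s') SX SY) compm0 comp0m.
Qed.

End AdditiveCategory.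

(** * Null-homotopies and mapping cones *)

Section Homotopy.
Variable A : pzRingType.
Local Notation D := (Dperf A).

Lemma kclass_eq0 (X Y : pcomplex A) (f : cmap X Y) :
  kclass f = 0 <-> nullhomotopic f.
Proof. by rewrite -[X in _ = X](raddf0 (\pi_(khom X Y)%qT)) -[f in X in _ <-> X]subr0 -kclassP. Qed.

Lemma nullhomotopic0 (X Y : pcomplex A) : nullhomotopic (0 : cmap X Y).
Proof. by have [/asboolP] := @nullhomotopic_zmod_closed A X Y. Qed.

Lemma kclass_iso (X Y : D) (f : cmap X Y) (g : cmap Y X) :
  nullhomotopic (cmap_comp f g - cmap_id X) ->
  nullhomotopic (cmap_comp g f - cmap_id Y) ->
  is_iso (kclass f : mor X Y).
Proof. by move=> /kclassP fg /kclassP gf; exists (kclass g); rewrite /= kcompE. Qed.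

Lemma cmap_iso (X Y : D) (f : cmap X Y) (g : cmap Y X) :
  (forall i, f i *m g i = pr X i) -> (forall i, g i *m f i = pr Y i) ->
  is_iso (kclass f : mor X Y).
Proof.
move=> fg gf; exists (kclass g); rewrite /= kcompE; congr kclass;
  exact: cmap_inj.
Qed.

(** Matrix sizes depend on the degree, so data given in the degrees [i + 1] reach all degrees only
    by transport along [i - 1 + 1 = i]; uniqueness of equality proofs on integers removes the
    transport again. *)
Lemma int_shift_family (G : int -> Type) (F : forall i, G (i + 1)) :
  exists F' : forall i, G i, forall i, F' (i + 1) = F i.
Proof.
exists (fun i => eq_rect (i - 1 + 1) G (F (i - 1)) i (subrK 1 i)) => i.
move: (subrK 1 (i + 1)); move: (i + 1 - 1) (addrK 1 i) => _ -> e.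
by rewrite (eq_irrelevance e erefl).
Qed.

Lemma int_shift_ind (P : int -> Prop) : (forall i, P (i + 1)) -> forall i, P i.
Proof. by move=> H i; rewrite -(subrK 1 i). Qed.

Lemma nullhomotopic_shift (X Y : pcomplex A) (f : cmap X Y)
    (h : forall i, 'M[A]_(rk X (i + 1 + 1), rk Y (i + 1))) :
  (forall i, pr X (i + 1 + 1) *m h i = h i /\ h i *m pr Y (i + 1) = h i) ->
  (forall i, f (i + 1 + 1) =
     df X (i + 1 + 1) *m h (i + 1) + h i *m df Y (i + 1)) ->
  nullhomotopic f.
Proof.
have [h' h'E] := @int_shift_family
  (fun i => 'M[A]_(rk X (i + 1), rk Y i)) h => hp hd; exists h'.
by split; apply: int_shift_ind => i; rewrite ?h'E.
Qed.

Lemma cmap_shift_family (X Y : pcomplex A)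
    (h : forall i, 'M[A]_(rk X (i + 1), rk Y (i + 1))) :
  (forall i, [/\ pr X (i + 1) *m h i = h i, h i *m pr Y (i + 1) = h i
    & h i *m df Y (i + 1) = df X (i + 1) *m h (i + 1)]) ->
  exists f : cmap X Y, forall i, f (i + 1) = h i.
Proof.
have [h' h'E] := @int_shift_family (fun i => 'M[A]_(rk X i, rk Y i)) h => hp.
suff hc : is_cmap h' by exists (mk_cmap hc).
by apply: int_shift_ind => i; rewrite !h'E.
Qed.

Section Cone.
Variables (X Y : pcomplex A) (u : cmap X Y).

Lemma mcone_comp0 : nullhomotopic (cmap_comp u (mcone_in u)).
Proof.
exists (fun i => row_mx (pr X (i + 1)) 0); split=> i.
  by rewrite mul_mx_row prK mulmx0 mul_row_block !mulmx0 !mul0mx !addr0 prK.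
have -> : cmap_comp u (mcone_in u) (i + 1) =
  u (i + 1) *m row_mx 0 (pr Y (i + 1)) by [].
have [u1 u2 _] := cmapE u (i + 1).
rewrite !mul_mx_row !mulmx0 mul_row_block !mul0mx !addr0 u1 u2.
by rewrite mulmxN prdf dfpr add_row_mx subrr add0r.
Qed.

Lemma mcone_out_comp0 : nullhomotopic (cmap_comp (mcone_out u) (cmap_shift u)).
Proof.
exists (fun i => col_mx 0 (pr Y (i + 1))); split=> i.
  by rewrite mul_block_col !mul0mx !mulmx0 !add0r mul_col_mx mul0mx prK.
have -> : cmap_comp (mcone_out u) (cmap_shift u) (i + 1) =
  col_mx (pr X (i + 1 + 1)) 0 *m u (i + 1 + 1) by [].
have [u1 u2 _] := cmapE u (i + 1 + 1).
rewrite mul_col_mx !mul0mx mul_block_col !mulmx0 !add0r u1 u2.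
by rewrite mul_col_mx mul0mx mulmxN prdf dfpr add_col_mx addr0 subrr.
Qed.

(** A null-homotopy of [u] followed by [f] is the missing component, on the shifted copy of [X], of
    a chain map on the cone that extends [f]. *)
Lemma mcone_extend (W : pcomplex A) (f : cmap Y W) :
  nullhomotopic (cmap_comp u f) ->
  exists g : cmap (mcone u) W, cmap_comp (mcone_in u) g = f.
Proof.
move=> [h [hp hd]].
have gP : is_cmap (X := mcone u) (Y := W) (fun i => col_mx (h i) (f i)).
  move=> i; have [h1 h2] := hp i; have [f1 f2 f3] := cmapE f i; split=> /=.
  - by rewrite mul_block_col !mul0mx addr0 add0r h1 f1.
  - by rewrite mul_col_mx h2 f2.
  rewrite mul_col_mx mul_block_col mul0mx add0r f3; congr col_mx.
  have -> : u (i + 1) *m f (i + 1) = cmap_comp u f (i + 1) by [].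
  by rewrite hd mulNmx addKr.
exists (mk_cmap gP); apply: cmap_inj => i.
have -> : cmap_comp (mcone_in u) (mk_cmap gP) i =
  row_mx 0 (pr Y i) *m col_mx (h i) (f i) by [].
by rewrite mul_row_col mul0mx add0r; have [] := cmapE f i.
Qed.

(** A null-homotopy [k] of the restriction of [b] to [Y], extended by 0 to the cone, deforms [b]
    into a map that vanishes on [Y]. *)
Lemma mcone_factor (W : pcomplex A) (b : cmap (mcone u) W) :
  nullhomotopic (cmap_comp (mcone_in u) b) ->
  exists b' : cmap (cshift X) W, kclass b = kclass (cmap_comp (mcone_out u) b').
Proof.
move=> [k [kp kd]].
pose b1 i := usubmx (b i : 'M[A]_(rk X (i + 1) + rk Y i, rk W i)).
pose b2 i := dsubmx (b i : 'M[A]_(rk X (i + 1) + rk Y i, rk W i)).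
have bE i : b i = col_mx (b1 i) (b2 i) by rewrite vsubmxK.
have kd' i : b2 (i + 1) = df Y (i + 1) *m k (i + 1) + k i *m df W i.
  rewrite -kd.
  have -> : cmap_comp (mcone_in u) b (i + 1) =
    row_mx 0 (pr Y (i + 1)) *m b (i + 1) by [].
  have [+ _ _] := cmapE b (i + 1); rewrite bE /= /cone_pr mul_block_col.
  rewrite !mul0mx addr0 add0r => /eq_col_mx[_ e].
  by rewrite mul_row_col mul0mx add0r e.
have bP i : [/\ pr X (i + 1) *m b1 i = b1 i, b1 i *m pr W i = b1 i
    & b1 i *m df W i = - df X (i + 1) *m b1 (i + 1) + u (i + 1) *m b2 (i + 1)].
  have := cmapE b i; rewrite !bE /= /cone_pr /cone_df !mul_block_col !mul_col_mx.
  rewrite !mul0mx addr0 => -[/eq_col_mx[e1 _] /eq_col_mx[e2 _] /eq_col_mx[e3 _]].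
  by split.
have [b' b'E] : exists b' : cmap (cshift X) W, forall i,
    b' (i + 1) = b1 (i + 1) - u (i + 1 + 1) *m k (i + 1).
  apply: (@cmap_shift_family (cshift X) W
    (fun i => b1 (i + 1) - u (i + 1 + 1) *m k (i + 1))) => i /=.
  have [e1 e2 e3] := bP (i + 1); have [u1 u2 u3] := cmapE u (i + 1 + 1).
  have [k1 k2] := kp (i + 1).
  split.
  - by rewrite mulmxBr e1 mulmxA u1.
  - by rewrite mulmxBl e2 -mulmxA k2.
  rewrite mulmxBl e3 kd' mulmxDr -!mulmxA addrA addrK mulmxBr; congr (_ + _).
  by rewrite mulNmx opprK !mulmxA u3.
exists b'; apply/kclassP; exists (fun i => col_mx 0 (k i)); split=> i.
  have [k1 k2] := kp i.
  by rewrite mul_block_col !mul0mx mulmx0 !add0r mul_col_mx mul0mx k1 k2.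
have -> : (b - cmap_comp (mcone_out u) b') (i + 1) =
  b (i + 1) - col_mx (pr X (i + 1 + 1)) 0 *m b' (i + 1) by [].
have [b'1 _ _] := cmapE b' (i + 1).
rewrite mul_col_mx mul0mx b'1 b'E bE mul_block_col mul_col_mx !mul0mx.
rewrite mulmx0 !add0r opp_col_mx !add_col_mx oppr0 !addr0 kd'.
by congr col_mx; rewrite opprB [LHS]addrC subrK.
Qed.

(** The [Y]-component [t] of the given null-homotopy is a chain map, and minus its [X]-component is
    a homotopy between [a] and [u] followed by [t]. *)
Lemma mcone_out_extend (W : pcomplex A) (a : cmap X W) :
  nullhomotopic (cmap_comp (mcone_out u) (cmap_shift a)) ->
  exists b : cmap Y W, kclass a = kclass (cmap_comp u b).
Proof.
move=> [k [kp kd]].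
pose s i : 'M[A]_(rk X (i + 1 + 1), rk W (i + 1)) :=
  usubmx (k i : 'M[A]_(rk X (i + 1 + 1) + rk Y (i + 1), rk W (i + 1))).
pose t i : 'M[A]_(rk Y (i + 1), rk W (i + 1)) :=
  dsubmx (k i : 'M[A]_(rk X (i + 1 + 1) + rk Y (i + 1), rk W (i + 1))).
have kE i : k i = col_mx (s i) (t i) by rewrite vsubmxK.
have kP i : [/\ pr X (i + 1 + 1) *m s i = s i, s i *m pr W (i + 1) = s i,
    pr Y (i + 1) *m t i = t i & t i *m pr W (i + 1) = t i].
  have [] := kp i; rewrite kE /= /cone_pr mul_block_col mul_col_mx !mul0mx addr0 add0r.
  by move=> /eq_col_mx[? ?] /eq_col_mx[? ?].
have kD i : a (i + 1 + 1) = - df X (i + 1 + 1) *m s (i + 1)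
      + u (i + 1 + 1) *m t (i + 1) - s i *m df W (i + 1) /\
    df Y (i + 1) *m t (i + 1) = t i *m df W (i + 1).
  have := kd i.
  have -> : cmap_comp (mcone_out u) (cmap_shift a) (i + 1) =
    col_mx (pr X (i + 1 + 1)) 0 *m a (i + 1 + 1) by [].
  have [a1 _ _] := cmapE a (i + 1 + 1).
  rewrite /= /cone_df !kE mul_col_mx mul_block_col !mul0mx mulmxN mul_col_mx opp_col_mx.
  rewrite add_col_mx a1 add0r => /eq_col_mx[-> /esym/eqP].
  by rewrite subr_eq0 => /eqP.
have [b bE] : exists b : cmap Y W, forall i, b (i + 1) = t i.
  by apply: cmap_shift_family => i; have [_ _ ? ?] := kP i; have [_ ->] := kD i.
exists b; apply/kclassP; apply: (@nullhomotopic_shift _ _ _ (fun i => - s i)) => i.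
  by have [s1 s2 _ _] := kP i; rewrite mulmxN mulNmx s1 s2.
have -> : (a - cmap_comp u b) (i + 1 + 1) =
  a (i + 1 + 1) - u (i + 1 + 1) *m b (i + 1 + 1) by [].
have [-> _] := kD i; rewrite bE mulNmx mulmxN mulNmx.
by rewrite [LHS]addrAC addrK.
Qed.

End Cone.
End Homotopy.

(** * Triangles and complexes of constant rank *)

Section Triangles.
Variable A : pzRingType.
Local Notation D := (Dperf A).

Definition kmor (X Y : D) (f : cmap X Y) : mor X Y := kclass f.

Lemma kmor_repr (X Y : D) (f : mor X Y) : exists f' : cmap X Y, f = kmor f'.
Proof. by exists (repr f); rewrite /kmor kreprK. Qed.

Lemma kmor_comp (X Y Z : D) (f : cmap X Y) (g : cmap Y Z) :
  kmor f ;; kmor g = kmor (cmap_comp f g).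
Proof. exact: kcompE. Qed.

Lemma kmor_susp (X Y : D) (f : cmap X Y) :
  suspm (kmor f) = kmor (X := susp X) (Y := susp Y) (cmap_shift f).
Proof. exact: kshiftE. Qed.

Lemma kmor_eq0 (X Y : D) (f : cmap X Y) : kmor f = 0 <-> nullhomotopic f.
Proof. exact: kclass_eq0. Qed.

Lemma distinguishedP (X Y Z : D) (f : mor X Y) (g : mor Y Z)
    (h : mor Z (susp X)) : distinguished f g h <->
  exists (X' Y' : D) (u : cmap X' Y') (a : mor X X') (b : mor Y Y')
    (c : mor Z (mcone u : D)),
    [/\ [/\ is_iso a, is_iso b & is_iso c],
        f ;; b = a ;; kmor u, g ;; c = b ;; kmor (mcone_in u : cmap _ (mcone u : D))
      & h ;; suspm a = c ;; kmor (mcone_out u : cmap _ (susp X'))].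
Proof. by []. Qed.

Lemma distinguished_extend (X Y Z W : D) (f : mor X Y) (g : mor Y Z)
    (h : mor Z (susp X)) (a : mor Y W) : distinguished f g h -> f ;; a = 0 ->
  exists b : mor Z W, a = g ;; b.
Proof.
move=> /distinguishedP[X' [Y' [u [ia [ib [ic [[[ja aj ja'] [jb bj jb'] _] hf hg _]]]]]]].
move=> fa; have [e eE] := kmor_repr (jb ;; a).
have [|e' e'E] := @mcone_extend _ _ _ u W e.
  apply/kmor_eq0; rewrite -kmor_comp -eE -(comp1m (kmor u)) -ja'.
  by rewrite -!compA (compA ia) -hf -compA (compA ib) bj comp1m fa compm0.
exists (ic ;; kmor (e' : cmap (mcone u : D) W)).
by rewrite compA hg -compA kmor_comp e'E -eE compA bj comp1m.
Qed.

(** Exactness of [mor _ W] at [X], where [distinguished_extend] is exactness at [Y]. *)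
Lemma distinguished_out_extend (X Y Z W : D) (f : mor X Y) (g : mor Y Z)
    (h : mor Z (susp X)) (a : mor X W) : distinguished f g h ->
  h ;; suspm a = 0 -> exists b : mor Y W, a = f ;; b.
Proof.
move=> /distinguishedP[X' [Y' [u [ia [ib [ic [[[ja aj ja'] _ [jc cj jc']] hf _ hh]]]]]]].
move=> ha; have [e eE] := kmor_repr (ja ;; a).
have [|e' e'E] := @mcone_out_extend _ _ _ u W e.
  apply/kmor_eq0.
  rewrite -[kmor _](@kmor_comp (mcone u) (susp X') (susp W)) -kmor_susp -eE.
  rewrite suspmM -(comp1m (kmor (mcone_out u))) -jc' -!compA (compA ic) -hh.
  by rewrite -compA (compA (suspm ia)) -suspmM aj suspm1 comp1m ha compm0.
exists (ib ;; kmor e').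
have eu : kmor e = kmor (cmap_comp u e') := e'E.
rewrite compA hf -compA kmor_comp -eu -eE.
by rewrite compA aj comp1m.
Qed.

Lemma distinguished_hom0 (X Y Z W : D) : is_distinguished X Y Z ->
  (forall f : mor X W, f = 0) -> (forall f : mor Z W, f = 0) ->
  forall f : mor Y W, f = 0.
Proof.
move=> [f [g [h d]]] XW ZW a; have [b ->] := distinguished_extend d (XW (f ;; a)).
by rewrite (ZW b) compm0.
Qed.

Lemma distinguished_isom (X Y Z X' Y' Z' : D) : is_distinguished X Y Z ->
  isom X X' -> isom Y Y' -> isom Z Z' -> is_distinguished X' Y' Z'.
Proof.
move=> [f [g [h /distinguishedP[X0 [Y0 [u [a [b [c [[ia ib ic] hf hg hh]]]]]]]]]].
move=> [x [x' xx' x'x]] [y [y' yy' y'y]] [z [z' zz' z'z]].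
exists (x' ;; f ;; y), (y' ;; g ;; z), (z' ;; h ;; suspm x).
apply/distinguishedP; exists X0, Y0, u, (x' ;; a), (y' ;; b), (z' ;; c); split.
- by split; apply: is_iso_comp => //; [exists x|exists y|exists z].
- by rewrite -!compA (compA y) yy' comp1m hf.
- by rewrite -!compA (compA z) zz' comp1m hg.
- by rewrite suspmM -!compA (compA (suspm x)) -suspmM xx' suspm1 comp1m hh.
Qed.

Lemma mcone_distinguished (X Y : D) (u : cmap X Y) :
  is_distinguished X Y (mcone u).
Proof.
exists (kmor u), (kmor (mcone_in u)), (kmor (mcone_out u)); apply/distinguishedP.
exists X, Y, u, (idm X), (idm Y), (idm (mcone u : D)).
rewrite ?suspm1 ?comp1m ?compm1; split=> //.
by split; [exists (idm X)|exists (idm Y)|exists (idm (mcone u : D))];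
  rewrite comp1m.
Qed.

(** Consecutive maps of the triangle compose to 0 and [u] is invertible, so both maps at the cone
    vanish. The identity of the cone vanishes on [Y], hence factors through the zero map
    [mcone_out u]. *)
Lemma mcone_iso_zero (X Y : D) (u : cmap X Y) :
  is_iso (kmor u) -> is_zero (mcone u : D).
Proof.
move=> [v uv vu].
have in0 : kmor (mcone_in u) = 0 :> mor Y (mcone u : D).
  rewrite -(comp1m (kmor _)) -vu -compA.
  have -> : kmor u ;; kmor (mcone_in u) = 0 :> mor X (mcone u : D).
    by rewrite kmor_comp; apply/kmor_eq0; exact: mcone_comp0.
  by rewrite compm0.
have out0 : kmor (mcone_out u) = 0 :> mor (mcone u : D) (susp X).
  rewrite -(compm1 (kmor _)) -suspm1 -uv suspmM compA.
  have -> : kmor (mcone_out u) ;; suspm (kmor u) = 0 :> mor (mcone u : D) (susp Y).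
    by rewrite kmor_susp kmor_comp; apply/kmor_eq0; exact: mcone_out_comp0.
  by rewrite comp0m.
have [|b bE] := @mcone_factor _ _ _ u (mcone u) (cmap_id (mcone u)).
  by apply/kmor_eq0; rewrite -kmor_comp in0 comp0m.
rewrite /is_zero -[LHS]/(kclass (cmap_id (mcone u))) bE.
by rewrite -[LHS](@kmor_comp (mcone u) (susp X) (mcone u)) out0 comp0m.
Qed.

End Triangles.

(** * Complexes of constant rank *)

Section ConstantRank.
Variable A : pzRingType.
Local Notation D := (Dperf A).

(* Complexes all of whose terms have the same rank n: matrices in different
   degrees have the same size, so that reindexing needs no casts. *)
Definition is_cpx n (p d : int -> 'M[A]_n) :=
  (forall i, [/\ p i *m p i = p i, p i *m d i = d i, d i *m p (i + 1) = d i
     & d i *m d (i + 1) = 0]) /\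
  exists N : nat, forall i, (N < `|i|)%N -> p i = 0.

Section Cpx.
Variables (n : nat) (p d : int -> 'M[A]_n) (H : is_cpx p d).

Fact cpx_pp i : p i *m p i = p i. Proof. by have [] := H.1 i. Qed.
Fact cpx_pd i : p i *m d i = d i. Proof. by have [] := H.1 i. Qed.
Fact cpx_dp i : d i *m p (i + 1) = d i. Proof. by have [] := H.1 i. Qed.
Fact cpx_dd i : d i *m d (i + 1) = 0. Proof. by have [] := H.1 i. Qed.

Definition cpx : D := @PComplex A (fun=> n) p d cpx_pp cpx_pd cpx_dp cpx_dd H.2.

End Cpx.

(** Every term is padded to the largest rank [n] occurring in the degrees from -N to N, outside
    which the idempotents vanish. *)
Lemma cpx_model (X : D) : exists n (p d : int -> 'M[A]_n) (H : is_cpx p d),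
  isom X (cpx H).
Proof.
have [N XN] := pcbounded X.
pose n := \max_(i < N.*2.+1) rk X ((i : nat)%:Z - N%:Z).
have rkn (i : int) : (`|i| <= N)%N -> (rk X i <= n)%N.
  move=> iN; have ltj : (`|(i + N%:Z)%R| < N.*2.+1)%N by lia.
  have := leq_bigmax (F := fun i : 'I_N.*2.+1 => rk X ((i : nat)%:Z - N%:Z)) (Ordinal ltj).
  by have -> : (Ordinal ltj : nat)%:Z - N%:Z = i by rewrite /=; lia.
pose u i : 'M[A]_(rk X i, n) := pid_mx (rk X i).
pose v i : 'M[A]_(n, rk X i) := pid_mx (rk X i).
(* Beyond [N] the rank may exceed [n]; there both sides are 0. *)
have uv i : pr X i *m u i *m v i = pr X i.
  have [iN|Ni] := leqP `|i| N; last by rewrite XN // !mul0mx.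
  by rewrite -mulmxA mul_pid_mx minnn (minn_idPr (rkn i iN)) pid_mx_1 mulmx1.
have uvdf i : df X i *m u (i + 1) *m v (i + 1) = df X i.
  by rewrite -(dfpr X) -!mulmxA (mulmxA (pr X _)) uv.
have H : is_cpx (fun i => v i *m pr X i *m u i) (fun i => v i *m df X i *m u (i + 1)).
  split=> [i|]; last by exists N => i iN; rewrite XN // mulmx0 mul0mx.
  split.
  - by rewrite -!mulmxA (mulmxA (u i)) (mulmxA (pr X i)) (mulmxA (pr X i)) uv (mulmxA (pr X i)) prK.
  - by rewrite -!mulmxA (mulmxA (pr X i)) (mulmxA (pr X i *m _)) uv (mulmxA (pr X i)) prdf.
  - by rewrite -!mulmxA (mulmxA (df X i)) (mulmxA (df X i *m _)) uvdf (mulmxA (df X i)) dfpr.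
  - by rewrite -!mulmxA (mulmxA (df X i)) (mulmxA (df X i *m _)) uvdf (mulmxA (df X i)) dfdf mul0mx mulmx0.
exists n, _, _, H.
have f1 : is_cmap (X := X) (Y := cpx H) (fun i => pr X i *m u i).
  move=> i; split=> /=.
  - by rewrite mulmxA prK.
  - by rewrite -!mulmxA (mulmxA (pr X i)) (mulmxA (pr X i *m _)) uv mulmxA prK.
  - by rewrite -!mulmxA (mulmxA (pr X i)) (mulmxA (pr X i *m _)) uv mulmxA prdf mulmxA dfpr.
have g1 : is_cmap (X := cpx H) (Y := X) (fun i => v i *m pr X i).
  move=> i; split=> /=.
  - by rewrite -!mulmxA (mulmxA (u i)) (mulmxA (pr X i)) (mulmxA (pr X i)) uv prK.
  - by rewrite -mulmxA prK.
  - by rewrite -!mulmxA prdf (mulmxA (df X i)) (mulmxA (df X i *m _)) uvdf dfpr.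
exists (kmor (mk_cmap f1)); apply: (@cmap_iso _ X (cpx H) _ (mk_cmap g1)) => i.
  by rewrite -[LHS]/(pr X i *m u i *m (v i *m pr X i)) mulmxA uv prK.
by rewrite -[LHS]/(v i *m pr X i *m (pr X i *m u i)) !mulmxA -(mulmxA (v i)) prK.
Qed.

End ConstantRank.

(** * Triangles of degreewise split subcomplexes *)

Section SplitTriangles.
Variable A : pzRingType.
Local Notation D := (Dperf A).

Section SplitSub.
Variables (n : nat) (p d e dE q dq : int -> 'M[A]_n).
Variables (H : is_cpx p d) (He : is_cpx e dE) (Hq : is_cpx q dq).
Hypotheses (pE : forall i, p i = e i + q i).
Hypotheses (eq0 : forall i, e i *m q i = 0) (qe0 : forall i, q i *m e i = 0).
Hypotheses (dEE : forall i, dE i = e i *m d i).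
Hypotheses (dqE : forall i, dq i = d i *m q (i + 1)).
Hypotheses (edq : forall i, e i *m d i *m q (i + 1) = 0).

Let ee i : e i *m e i = e i. Proof. exact: (cpx_pp He). Qed.
Let qq i : q i *m q i = q i. Proof. exact: (cpx_pp Hq). Qed.
Let ep i : e i *m p i = e i. Proof. by rewrite pE mulmxDr ee eq0 addr0. Qed.
Let pe i : p i *m e i = e i. Proof. by rewrite pE mulmxDl ee qe0 addr0. Qed.
Let pq i : p i *m q i = q i. Proof. by rewrite pE mulmxDl qq eq0 add0r. Qed.
Let qp i : q i *m p i = q i. Proof. by rewrite pE mulmxDr qq qe0 add0r. Qed.
Let ede i : e i *m d i *m e (i + 1) = e i *m d i.
Proof.
have : e i *m d i *m p (i + 1) = e i *m d i by rewrite -mulmxA (cpx_dp H).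
by rewrite pE mulmxDr edq addr0.
Qed.
Let dqdeB i : d i = d i *m e (i + 1) + d i *m q (i + 1).
Proof. by rewrite -mulmxDr -pE (cpx_dp H). Qed.
Let edqd i : d i = e i *m d i + q i *m d i.
Proof. by rewrite -mulmxDl -pE (cpx_pd H). Qed.
Let qdq i : q i *m d i *m q (i + 1) = d i *m q (i + 1).
Proof. by rewrite [in RHS]edqd mulmxDl edq add0r. Qed.
Let qde i : q i *m d i *m e (i + 1) = d i *m e (i + 1) - e i *m d i.
Proof. by rewrite [in X in X - _]edqd mulmxDl ede [RHS]addrC addKr. Qed.
Let dd i : d i *m d (i + 1) = 0. Proof. exact: (cpx_dd H). Qed.

Fact split_sub_in_subproof : is_cmap (X := cpx He) (Y := cpx H) e.
Proof. by move=> i /=; rewrite dEE ee ep ede. Qed.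
Let u : cmap (cpx He) (cpx H) := mk_cmap split_sub_in_subproof.

Fact split_sub_out_subproof : is_cmap (X := cpx H) (Y := cpx Hq) q.
Proof. by move=> i /=; rewrite dqE pq qq mulmxA qdq. Qed.
Let g : cmap (cpx H) (cpx Hq) := mk_cmap split_sub_out_subproof.

(** Minus the component [q d e] of [d] from the quotient to the subcomplex. *)
Let s i := e i *m d i - d i *m e (i + 1).

Let qs i : q i *m s i = s i.
Proof. by rewrite mulmxBr !mulmxA qe0 mul0mx sub0r qde opprB. Qed.

Let se i : s i *m e (i + 1) = s i.
Proof. by rewrite mulmxBl ede -mulmxA ee. Qed.

Let sqd i : s i + q i *m d i = d i *m q (i + 1).
Proof. by rewrite addrAC -edqd [in X in X - _]dqdeB [LHS]addrC addKr. Qed.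

Let dqs i : d i *m q (i + 1) *m s (i + 1) = d i *m e (i + 1) *m d (i + 1).
Proof.
rewrite -mulmxA qs mulmxBr !mulmxA dd mul0mx subr0 //.
Qed.

Fact split_sub_cone_subproof :
  is_cmap (X := cpx Hq) (Y := mcone u) (fun i => row_mx (s i) (q i)).
Proof.
move=> i; split; rewrite /= ?/cone_pr ?/cone_df.
- by rewrite mul_mx_row qs qq.
- by rewrite mul_row_block !mulmx0 addr0 add0r /= se qp.
rewrite mul_row_block mulmx0 addr0 mul_mx_row /= dqE dqs -[_ *m q _ *m q _]mulmxA qq se sqd.
congr row_mx; rewrite mulmxN dEE mulmxA se mulmxBl -[in X in X - _]mulmxA dd.
by rewrite mulmx0 sub0r opprK.
Qed.
Let c : cmap (cpx Hq) (mcone u) := mk_cmap split_sub_cone_subproof.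

Fact split_sub_uncone_subproof :
  is_cmap (X := mcone u) (Y := cpx Hq) (fun i => col_mx 0 (q i)).
Proof.
move=> i; split; rewrite /= ?/cone_pr ?/cone_df.
- by rewrite mul_block_col !mul0mx mulmx0 !add0r pq.
- by rewrite mul_col_mx mul0mx qq.
rewrite mul_col_mx mul_block_col !mul0mx mulmx0 !add0r dqE mulmxA qdq.
by rewrite (eq0 (i + 1)).
Qed.
Let c' : cmap (mcone u) (cpx Hq) := mk_cmap split_sub_uncone_subproof.

Fact split_sub_cone_iso : is_iso (kmor (c : cmap (cpx Hq) (mcone u : D))).
Proof.
apply: (@kclass_iso _ (cpx Hq) (mcone u) c c').
  have -> : cmap_comp c c' - cmap_id (cpx Hq) = 0.
    apply: cmap_inj => i.
    have -> : (cmap_comp c c' - cmap_id (cpx Hq)) i =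
      row_mx (s i) (q i) *m col_mx 0 (q i) - q i by [].
    by rewrite mul_row_col mulmx0 add0r qq subrr.
  exact: nullhomotopic0.
(* The homotopy contracts the part [e] of [p] against the shifted copy of [e] in the cone. *)
exists (fun i => block_mx 0 0 (- e (i + 1)) 0); split=> i.
  rewrite /= /cone_pr !mulmx_block !mulmx0 !mul0mx !addr0 !add0r.
  by rewrite mulmxN mulNmx ee pe.
have -> : (cmap_comp c' c - cmap_id (mcone u)) (i + 1) =
  col_mx 0 (q (i + 1)) *m row_mx (s (i + 1)) (q (i + 1)) -
    block_mx (e (i + 1 + 1)) 0 0 (p (i + 1)) by [].
rewrite mul_col_row !mul0mx opp_block_mx add_block_mx !oppr0 !addr0 !add0r.
rewrite /= /cone_df !mulmx_block !mulmx0 !mul0mx !addr0 !add0r.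
rewrite !mulmxN !mulNmx opprK ee qq qs pE add_block_mx !addr0 !add0r /=.
rewrite dEE mulmxA !ee opprD addrCA subrr addr0.
by rewrite [in X in _ = block_mx _ _ X _]addrC.
Qed.

(** Matrices act on row vectors, so [edq] says that [d] preserves the part cut out by [e], with
    quotient the part cut out by [q]. The map with components [s] and [q] identifies this quotient
    with the cone of the inclusion. *)
Lemma split_sub_distinguished : is_distinguished (cpx He) (cpx H) (cpx Hq).
Proof.
exists (kmor u), (kmor g), (kmor c ;; kmor (mcone_out u)); apply/distinguishedP.
exists (cpx He), (cpx H), u, (idm _), (idm _), (kmor c).
rewrite suspm1 !compm1 !comp1m; split=> //.
  by split; [exists (idm _)|exists (idm _)|exact: split_sub_cone_iso];
    rewrite comp1m.
rewrite kmor_comp; apply/kclassP.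
(* The two maps into the cone differ by the boundary of minus the projection onto the subcomplex. *)
exists (fun i => row_mx (- e (i + 1)) 0); split=> i.
  rewrite /= /cone_pr mul_mx_row mul_row_block !mulmx0 !mul0mx !addr0.
  by rewrite mulmxN mulNmx ee pe.
have -> : (cmap_comp g c - mcone_in u) (i + 1) =
  q (i + 1) *m row_mx (s (i + 1)) (q (i + 1)) - row_mx 0 (p (i + 1)) by [].
rewrite /= /cone_df mul_mx_row mul_row_block opp_row_mx add_row_mx.
rewrite !mulmx0 !mul0mx !addr0 mul_mx_row mulmx0 add_row_mx.
rewrite qs qq oppr0 addr0 add0r !mulNmx !mulmxN opprK /= dEE mulmxA !ee pE.
by rewrite opprD addrCA subrr addr0 [in X in _ = row_mx X _]addrC.
Qed.

End SplitSub.
End SplitTriangles.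

(** * Modules placed in a single degree *)

Section Stalks.
Variable A : pzRingType.
Local Notation D := (Dperf A).

Lemma cpx_nullhomotopic n m (p d : int -> 'M[A]_n) (p' d' : int -> 'M[A]_m)
    (H : is_cpx p d) (H' : is_cpx p' d') (f : cmap (cpx H) (cpx H')) :
  nullhomotopic f -> exists h : int -> 'M[A]_(n, m), forall i,
    f i = d i *m h i + h (i - 1) *m d' (i - 1).
Proof.
move=> [h [_ hd]]; exists h; apply: int_shift_ind => i.
by rewrite (hd i) addrK.
Qed.

Lemma cpx_isom n (p d p' d' : int -> 'M[A]_n) (H : is_cpx p d)
    (H' : is_cpx p' d') :
  p =1 p' -> d =1 d' -> isom (cpx H) (cpx H').
Proof.
move=> pp' dd'.
have f1 : is_cmap (X := cpx H) (Y := cpx H') p.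
  by move=> i /=; rewrite -pp' -dd' (cpx_pp H) (cpx_pd H) (cpx_dp H).
have g1 : is_cmap (X := cpx H') (Y := cpx H) p.
  by move=> i /=; rewrite -pp' -dd' (cpx_pp H) (cpx_pd H) (cpx_dp H).
exists (kmor (mk_cmap f1 : cmap (cpx H) (cpx H'))).
apply: (@cmap_iso _ (cpx H) (cpx H') _ (mk_cmap g1)) => i.
  exact: (cpx_pp H).
by rewrite [RHS]/= -pp'; exact: (cpx_pp H).
Qed.

Lemma susp_cpx_subproof n (p d : int -> 'M[A]_n) : is_cpx p d ->
  is_cpx (fun i : int => p (i + 1)) (fun i : int => - d (i + 1)).
Proof.
move=> H; split=> [i|]; last exact: (shift_bounded (cpx H)).
split; [exact: (cpx_pp H)|exact: (shift_pr_df (cpx H))|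
  exact: (shift_df_pr (cpx H))|exact: (shift_df_df (cpx H))].
Qed.

Lemma susp_cpx n (p d : int -> 'M[A]_n) (H : is_cpx p d) :
  isom (susp (cpx H)) (cpx (susp_cpx_subproof H)).
Proof.
have f1 : is_cmap (X := susp (cpx H)) (Y := cpx (susp_cpx_subproof H))
    (fun i => p (i + 1)).
  by move=> i; rewrite /= mulmxN mulNmx (cpx_pp H) (cpx_pd H) (cpx_dp H).
have g1 : is_cmap (X := cpx (susp_cpx_subproof H)) (Y := susp (cpx H))
    (fun i => p (i + 1)).
  by move=> i; rewrite /= mulmxN mulNmx (cpx_pp H) (cpx_pd H) (cpx_dp H).
exists (kmor (mk_cmap f1 : cmap (susp (cpx H)) (cpx (susp_cpx_subproof H)))).
by apply: (@cmap_iso _ (susp (cpx H)) (cpx _) _ (mk_cmap g1)) => i;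
  exact: (cpx_pp H).
Qed.

Definition at_degree n m (a : int) (M : 'M[A]_(n, m)) (i : int) :=
  if i == a then M else 0.

Fact stalk_subproof n a (p : 'M[A]_n) :
  p *m p = p -> is_cpx (at_degree a p) (fun=> 0).
Proof.
move=> pp; split=> [i|].
  by rewrite /at_degree; case: eqP => _; rewrite ?mulmx0 ?mul0mx.
by exists `|a|%N => i; rewrite /at_degree; case: eqP => // ->; rewrite ltnn.
Qed.

(* The summand of A^n cut out by the idempotent p, placed in degree a. *)
Definition stalk n a (p : 'M[A]_n) (pp : p *m p = p) : D :=
  cpx (stalk_subproof a pp).

(** Isomorphic to the suspension of A iterated [- a] times, since [susp] lowers the degree by
    one. *)
Definition unit_stalk a : D := stalk a (mulmx1 (1%:M : 'M[A]_1)).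

Section StalkMaps.
Variables (n m : nat) (a : int) (p : 'M[A]_n) (q : 'M[A]_m).
Hypotheses (pp : p *m p = p) (qq : q *m q = q).

Lemma stalk_map (h : 'M[A]_(n, m)) : p *m h = h -> h *m q = h ->
  exists f : cmap (stalk a pp) (stalk a qq), forall i, f i = at_degree a h i.
Proof.
move=> ph hq; suff fP : is_cmap (X := stalk a pp) (Y := stalk a qq) (at_degree a h).
  by exists (mk_cmap fP).
move=> i /=; rewrite /at_degree mulmx0 mul0mx.
by case: eqP; rewrite ?mulmx0.
Qed.

Lemma stalk_isom (u : 'M[A]_(n, m)) (v : 'M[A]_(m, n)) :
  u *m v = p -> v *m u = q -> isom (stalk a pp) (stalk a qq).
Proof.
move=> uv vu.
have ph : p *m (p *m u *m q) = p *m u *m q by rewrite !mulmxA pp.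
have hq : p *m u *m q *m q = p *m u *m q by rewrite -mulmxA qq.
have [f fE] := stalk_map ph hq.
exists (kmor f).
have gP : is_cmap (X := stalk a qq) (Y := stalk a pp) (at_degree a (q *m v *m p)).
  move=> i /=; rewrite /at_degree mulmx0 mul0mx.
  by case: eqP; rewrite ?mulmx0 ?mul0mx // !mulmxA qq -[_ *m p *m p]mulmxA pp.
apply: (@cmap_iso _ (stalk a pp) (stalk a qq) _ (mk_cmap gP)) => i; rewrite fE.
- rewrite -[LHS]/(_ *m at_degree a _ i) /= /at_degree.
  case: eqP => _; last by rewrite mul0mx.
  rewrite !mulmxA -[_ *m q *m q]mulmxA qq -vu !mulmxA.
  by rewrite -(mulmxA p u v) uv pp -(mulmxA p u v) uv !pp.
- rewrite -[LHS]/(at_degree a _ i *m _) /= /at_degree.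
  case: eqP => _; last by rewrite mul0mx.
  rewrite !mulmxA -[_ *m p *m p]mulmxA pp -uv !mulmxA.
  by rewrite -(mulmxA q v u) vu qq -(mulmxA q v u) vu !qq.
Qed.

Lemma stalk_hom0 b : b != a -> forall f : mor (stalk a pp) (stalk b qq), f = 0.
Proof.
move=> ba f; have [f' ->] := kmor_repr f.
apply/kmor_eq0; suff -> : f' = 0 by exact: nullhomotopic0.
apply: cmap_inj => i; rewrite -[RHS]/(0 : 'M[A]_(_, _)).
have [+ + _] := cmapE f' i; rewrite /= /at_degree.
have [->|ia <- _] := eqVneq i a; last by rewrite mul0mx.
by rewrite eq_sym (negbTE ba) mulmx0.
Qed.

Lemma stalk_nullhomotopic (f : cmap (stalk a pp) (stalk a qq)) :
  nullhomotopic f -> f a = 0.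
Proof. by move=> /cpx_nullhomotopic[h ->]; rewrite mulmx0 mul0mx addr0. Qed.

End StalkMaps.

Lemma stalk_zeroP n a (p : 'M[A]_n) (pp : p *m p = p) :
  is_zero (stalk a pp) <-> p = 0.
Proof.
split=> [/kmor_eq0|p0].
  move=> /stalk_nullhomotopic; rewrite -[X in X = _]/(at_degree a p a).
  by rewrite /at_degree eqxx.
apply/kmor_eq0; suff -> : cmap_id (stalk a pp) = 0 by exact: nullhomotopic0.
apply: cmap_inj => i; rewrite -[LHS]/(at_degree a p i) /at_degree.
by case: eqP.
Qed.

Lemma susp_stalk n (a : int) (p : 'M[A]_n) (pp : p *m p = p) :
  isom (susp (stalk a pp)) (stalk (a - 1) pp).
Proof.
apply: (isom_trans (susp_cpx (stalk_subproof a pp))); apply: cpx_isom => i.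
  by rewrite /at_degree -subr_eq opprK.
exact: oppr0.
Qed.

Section StalkSplit.
Variables (n : nat) (a : int) (p e q : 'M[A]_n).
Hypotheses (pp : p *m p = p) (ee : e *m e = e) (qq : q *m q = q).
Hypotheses (pE : p = e + q) (eq0 : e *m q = 0) (qe0 : q *m e = 0).

Lemma stalk_split_distinguished :
  is_distinguished (stalk a ee) (stalk a pp) (stalk a qq).
Proof.
by apply: split_sub_distinguished => i; rewrite ?mulmx0 ?mul0mx //;
  rewrite /at_degree; case: eqP; rewrite ?mulmx0 ?addr0.
Qed.

Lemma stalk_split_biprod : is_biprod (stalk a ee) (stalk a qq) (stalk a pp).
Proof.
have ep : e *m p = e by rewrite pE mulmxDr ee eq0 addr0.
have pe : p *m e = e by rewrite pE mulmxDl ee qe0 addr0.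
have qp : q *m p = q by rewrite pE mulmxDr qq qe0 add0r.
have pq : p *m q = q by rewrite pE mulmxDl qq eq0 add0r.
have [i1 i1E] := stalk_map a ee pp ee ep.
have [i2 i2E] := stalk_map a qq pp qq qp.
have [p1 p1E] := stalk_map a pp ee pe ee.
have [p2 p2E] := stalk_map a pp qq pq qq.
exists (kmor i1), (kmor i2), (kmor p1), (kmor p2); rewrite !kmor_comp.
have K (X Y : D) (f g : cmap X Y) : (forall i, f i = g i) -> kmor f = kmor g.
  by move=> fg; congr kmor; exact: cmap_inj.
split.
- by apply: K => i; rewrite -[LHS]/(i1 i *m p1 i) i1E p1E -[RHS]/(at_degree a e i)
    /at_degree; case: eqP; rewrite ?mulmx0.
- by apply: K => i; rewrite -[LHS]/(i2 i *m p2 i) i2E p2E -[RHS]/(at_degree a q i)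
    /at_degree; case: eqP; rewrite ?mulmx0.
- apply/kmor_eq0; rewrite (_ : cmap_comp _ _ = 0); first exact: nullhomotopic0.
  by apply: cmap_inj => i; rewrite -[LHS]/(i1 i *m p2 i) i1E p2E -[RHS]/(0 : 'M[A]_(_, _))
    /at_degree; case: eqP; rewrite ?mulmx0.
- apply/kmor_eq0; rewrite (_ : cmap_comp _ _ = 0); first exact: nullhomotopic0.
  by apply: cmap_inj => i; rewrite -[LHS]/(i2 i *m p1 i) i2E p1E -[RHS]/(0 : 'M[A]_(_, _))
    /at_degree; case: eqP; rewrite ?mulmx0.
- rewrite -[LHS]kclassD; apply: K => i.
  rewrite -[LHS]/(p1 i *m i1 i + p2 i *m i2 i) i1E i2E p1E p2E.
  rewrite -[RHS]/(at_degree a p i) /at_degree.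
  by case: eqP; rewrite ?mulmx0 ?addr0 ?ee ?qq -?pE.
Qed.

End StalkSplit.

Lemma zero_object_exists : exists Z : D, is_zero Z.
Proof. by exists (stalk 0 (mulmx0 0 (0 : 'M[A]_0))); apply/stalk_zeroP. Qed.

Lemma distinguished_id (X : D) : exists2 Z : D, is_zero Z & is_distinguished X X Z.
Proof.
exists (mcone (cmap_id X)); last exact: mcone_distinguished.
by apply: mcone_iso_zero; exists (idm X); exact: comp1m.
Qed.

Lemma distinguished_susp (X : D) :
  exists2 Z : D, is_zero Z & is_distinguished X Z (susp X).
Proof.
pose Z : D := stalk 0 (mulmx0 0 (0 : 'M[A]_0)).
exists Z; first exact/stalk_zeroP.
pose u : cmap X Z := 0.
apply: (distinguished_isom (mcone_distinguished u)); try exact: isom_refl.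
exists (kmor (mcone_out u)).
have gP : is_cmap (X := susp X) (Y := mcone u) (fun i => row_mx (pr X (i + 1)) 0).
  move=> i; rewrite /= /cone_pr /cone_df; split.
  - by rewrite mul_mx_row prK mulmx0.
  - by rewrite mul_row_block !mulmx0 !mul0mx !addr0 prK.
  - rewrite mul_row_block mul_mx_row; congr row_mx.
      by rewrite mulmx0 addr0 mulmxN prdf mulNmx dfpr.
    by apply/matrixP => ? [].
apply: (@cmap_iso _ (mcone u) (susp X) _ (mk_cmap gP)) => i.
  rewrite -[LHS]/(col_mx (pr X (i + 1)) 0 *m row_mx (pr X (i + 1)) 0).
  rewrite mul_col_row prK !mulmx0 mul0mx /= /cone_pr.
  by congr block_mx; apply/matrixP => [[]].
rewrite -[LHS]/(row_mx (pr X (i + 1)) 0 *m col_mx (pr X (i + 1)) 0).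
by rewrite mul_row_col prK mulmx0 addr0.
Qed.

(** * Brutal truncations *)

Section Truncation.
Variables (n : nat) (p d : int -> 'M[A]_n) (H : is_cpx p d).

Definition trunc (a : int) (i : int) := if (a <= i)%R then p i else 0.

Fact trunc_subproof a : is_cpx (trunc a) (fun i => trunc a i *m d i).
Proof.
split=> [i|]; last first.
  by have [N HN] := H.2; exists N => i iN; rewrite /trunc HN // if_same.
rewrite /trunc; case: (lerP a i) => ai; last by rewrite !mul0mx.
have -> : a <= i + 1 by lia.
by rewrite !mulmxA !(cpx_pp H) !(cpx_pd H) (cpx_dp H) (cpx_dd H).
Qed.

Lemma trunc_distinguished (a : int) :
  is_distinguished (cpx (trunc_subproof (a + 1))) (cpx (trunc_subproof a))
    (stalk a (cpx_pp H a)).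
Proof.
apply: split_sub_distinguished => i; rewrite /trunc /at_degree.
- have [->|ia] := eqVneq i a; last by case: ifP; case: ifP; rewrite ?addr0 //; lia.
  by rewrite lexx; case: ifP; rewrite ?add0r //; lia.
- by case: eqP; case: ifP; rewrite ?mulmx0 ?mul0mx //; lia.
- by case: eqP; case: ifP; rewrite ?mulmx0 ?mul0mx //; lia.
- case: ifP => ai; last by rewrite !mul0mx.
  have -> : a <= i by lia.
  by rewrite !mulmxA (cpx_pp H).
- by case: (eqVneq (i + 1) a); case: ifP; rewrite ?mulmx0 ?mul0mx //; lia.
- by case: (eqVneq (i + 1) a); case: ifP; case: ifP; rewrite ?mulmx0 ?mul0mx //; lia.
Qed.

End Truncation.

Lemma trunc_zero n (p d : int -> 'M[A]_n) (H : is_cpx p d) (N : nat) (a : int) :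
  (forall i : int, (N < `|i|)%N -> p i = 0) -> N%:Z < a ->
  is_zero (cpx (trunc_subproof H a)).
Proof.
move=> HN Na; apply/kmor_eq0; rewrite (_ : cmap_id _ = 0).
  exact: nullhomotopic0.
apply: cmap_inj => i; rewrite -[LHS]/(trunc p a i) /trunc.
by case: ifP => // ai; rewrite HN //; lia.
Qed.

Lemma trunc_isom n (p d : int -> 'M[A]_n) (H : is_cpx p d) (N : nat) (a : int) :
  (forall i : int, (N < `|i|)%N -> p i = 0) -> a <= - N%:Z ->
  isom (cpx (trunc_subproof H a)) (cpx H).
Proof.
move=> HN Na; have tp i : trunc p a i = p i.
  by rewrite /trunc; case: ifP => // ai; rewrite HN //; lia.
by apply: cpx_isom => i; rewrite tp ?(cpx_pd H).
Qed.

(** The truncations at the degrees from N + 1 down to -N; each step adds the term in degree [N - i],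
    so the degrees of the factors decrease along the filtration. *)
Lemma stalk_filtration (X : D) : exists (n N : nat) (p : int -> 'M[A]_n)
    (pp : forall i, p i *m p i = p i) (E : nat -> D),
  [/\ is_zero (E 0%N), isom (E N.*2.+1) X
    & forall i : nat, is_distinguished (E i) (E i.+1)
        (stalk (N%:Z - i%:Z) (pp (N%:Z - i%:Z)))].
Proof.
have [n [p [d [H XH]]]] := cpx_model X; have [N HN] := H.2.
pose a (i : nat) : int := N%:Z - i%:Z + 1.
have a0 : N%:Z < a 0%N by rewrite /a; lia.
have aN : a N.*2.+1 <= - N%:Z by rewrite /a; lia.
have aS i : a i = a i.+1 + 1 by rewrite /a; lia.
have aE i : N%:Z - i%:Z = a i.+1 by rewrite /a; lia.
move: a a0 aN aS aE => a a0 aN aS aE.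
exists n, N, p, (cpx_pp H), (fun i => cpx (trunc_subproof H (a i))); split.
- exact: trunc_zero a0.
- by apply: isom_trans (isom_sym XH); apply: trunc_isom aN.
- by move=> i; rewrite aE (aS i); exact: trunc_distinguished.
Qed.

End Stalks.

(** * Minimal models *)

(** The row space of [Q] lies in that of [P], strictly because [E] kills the former and not the
    latter. *)
Lemma mxrank_idem_lt (F : fieldType) n (P Q E : 'M[F]_n) :
  Q *m P = Q -> Q *m E = 0 -> P *m E != 0 -> (\rank Q < \rank P)%N.
Proof.
move=> QP QE PE; have sQP : (Q <= P)%MS by rewrite -QP submxMl.
rewrite ltn_neqAle mxrankS // andbT; apply: contra PE => rQP.
have /submxP[M ->] : (P <= Q)%MS by rewrite -(mxrank_leqif_sup sQP).
by rewrite -mulmxA QE mulmx0.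
Qed.

Section LocalRing.
Variables (A : comNzRingType) (k : fieldType) (rho : {rmorphism A -> k}).
Hypothesis rho_unit : forall a, rho a != 0 -> exists b, a * b = 1.
Local Notation D := (Dperf A).

Lemma unit_entry n m (M : 'M[A]_(n, m)) : map_mx rho M != 0 ->
  exists (u : 'rV[A]_n) (v : 'cV[A]_m), u *m M *m v = 1%:M.
Proof.
move=> /matrix0Pn[r [s]]; rewrite mxE => /rho_unit[b Mb].
exists (delta_mx 0 r), (b *: delta_mx s 0); rewrite -rowE -scalemxAr -colE.
by apply/matrixP => i j; rewrite !ord1 !mxE mulrC Mb.
Qed.

(* If u d v = 1, then h = v u satisfies h d h = h, so that d h + h d is a
   null-homotopic idempotent chain map; removing it splits off a contractible
   summand A -> A in degrees i0 and i0 + 1. *)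
Section Elimination.
Variables (n : nat) (p d : int -> 'M[A]_n) (H : is_cpx p d) (i0 : int).
Variables (u : 'rV[A]_n) (v : 'cV[A]_n).
Hypotheses (up : u *m p i0 = u) (pv : p (i0 + 1) *m v = v).
Hypothesis udv : u *m d i0 *m v = 1%:M.

Let h := v *m u.
Let hp : h *m p i0 = h. Proof. by rewrite -mulmxA up. Qed.
Let ph : p (i0 + 1) *m h = h. Proof. by rewrite mulmxA pv. Qed.
Let hdh : h *m d i0 *m h = h.
Proof. by rewrite /h !mulmxA -(mulmxA v) -(mulmxA v) udv mulmx1. Qed.

Let e i := if i == i0 then d i0 *m h else if i == i0 + 1 then h *m d i0 else 0.

Variant degree_spec i : Type :=
| DegreeLow of i = i0 & e i = d i0 *m h
| DegreeHigh of i = i0 + 1 & e i = h *m d i0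
| DegreeOther of i != i0 & i != i0 + 1 & e i = 0.

Let degreeP i : degree_spec i.
Proof.
have [ii|ii] := eqVneq i i0; first by constructor 1; rewrite /e ?ii ?eqxx.
have [jj|jj] := eqVneq i (i0 + 1).
  by constructor 2; rewrite // /e (negbTE ii) jj eqxx.
by constructor 3; rewrite // /e (negbTE ii) (negbTE jj).
Qed.

Let ee i : e i *m e i = e i.
Proof.
case: (degreeP i) => [_ ->|_ ->|_ _ ->]; last by rewrite mulmx0.
  by rewrite -mulmxA [h *m _]mulmxA hdh.
by rewrite [LHS]mulmxA hdh.
Qed.

Let ep i : e i *m p i = e i.
Proof.
case: (degreeP i) => [-> ->|-> ->|_ _ ->]; last by rewrite mul0mx.
  by rewrite -mulmxA hp.
by rewrite -mulmxA (cpx_dp H).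
Qed.

Let pe i : p i *m e i = e i.
Proof.
case: (degreeP i) => [-> ->|-> ->|_ _ ->]; last by rewrite mulmx0.
  by rewrite mulmxA (cpx_pd H).
by rewrite mulmxA ph.
Qed.

Let ed i : e i *m d i = d i *m e (i + 1).
Proof.
case: (degreeP i) => [-> ->|-> ->|i1 i2 ->].
- case: (degreeP (i0 + 1)) => [|_ ->|]; [lia| |by rewrite eqxx].
  by rewrite mulmxA.
- case: (degreeP (i0 + 1 + 1)) => [|| _ _ ->]; [lia|lia|].
  by rewrite -mulmxA (cpx_dd H) !mulmx0.
- case: (degreeP (i + 1)) => [ii ->| |_ _ ->]; [|lia|by rewrite mul0mx mulmx0].
  by rewrite -ii !mulmxA (cpx_dd H) !mul0mx.
Qed.

Let p' i := p i - e i.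
Let p'p' i : p' i *m p' i = p' i.
Proof. by rewrite mulmxBr !mulmxBl (cpx_pp H) ep pe ee subrr subr0. Qed.
Let p'p i : p' i *m p i = p' i.
Proof. by rewrite mulmxBl (cpx_pp H) ep. Qed.
Let pp' i : p i *m p' i = p' i.
Proof. by rewrite mulmxBr (cpx_pp H) pe. Qed.
Let p'd i : p' i *m d i = d i *m p' (i + 1).
Proof. by rewrite mulmxBl mulmxBr (cpx_pd H) (cpx_dp H) ed. Qed.

Fact elimination_subproof : is_cpx p' (fun i => p' i *m d i).
Proof.
split=> [i|].
  split; rewrite ?mulmxA ?p'p' //.
    by rewrite -mulmxA -p'd mulmxA p'p'.
  by rewrite -(mulmxA _ (d i)) -p'd -!mulmxA (cpx_dd H) !mulmx0.
have [N HN] := H.2; exists N => i Ni.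
by rewrite -(pp' i) HN // mul0mx.
Qed.

Lemma elimination_isom : isom (cpx H) (cpx elimination_subproof).
Proof.
have fP : is_cmap (X := cpx H) (Y := cpx elimination_subproof) p'.
  by move=> i /=; split; rewrite ?pp' ?p'p' // mulmxA p'p'.
have gP : is_cmap (X := cpx elimination_subproof) (Y := cpx H) p'.
  by move=> i /=; split; rewrite ?p'p ?p'p' // -mulmxA -p'd mulmxA p'p'.
exists (kmor (mk_cmap fP : cmap (cpx H) (cpx elimination_subproof))).
apply: (@kclass_iso _ (cpx H) (cpx elimination_subproof) _ (mk_cmap gP)).
  exists (fun i => if i == i0 then - h else 0); split=> i.
    by case: eqP => [->|_]; rewrite ?mulmx0 ?mul0mx // mulmxN mulNmx /= hp ph.
  rewrite -[LHS]/(p' (i + 1) *m p' (i + 1) - p (i + 1)) p'p'.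
  rewrite /p' [LHS]addrAC subrr add0r /=.
  case: (degreeP (i + 1)) => [ii ->|ii ->|ii jj ->].
  - rewrite ii eqxx; case: eqP => [iI|_]; first lia.
    by rewrite mul0mx addr0 mulmxN.
  - have -> : i = i0 by apply: (addIr 1).
    by rewrite eqxx; case: eqP => [|_]; [lia|rewrite mulmx0 add0r mulNmx].
  - rewrite (negbTE ii); case: eqP => [iI|_]; first by rewrite iI eqxx in jj.
    by rewrite mulmx0 mul0mx addr0 oppr0.
rewrite (_ : _ - _ = 0); first exact: nullhomotopic0.
apply: cmap_inj => i; rewrite -[LHS]/(p' i *m p' i - p' i) p'p' subrr //.
Qed.

Lemma elimination_zero i : p i = 0 -> p' i = 0.
Proof. by move=> pi0; rewrite -pp' pi0 mul0mx. Qed.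

Lemma elimination_rank i : (\rank (map_mx rho (p' i)) <= \rank (map_mx rho (p i)))%N.
Proof. by rewrite -p'p map_mxM mxrankM_maxr. Qed.

(** In degree [i0] one has [u e d v = u d v u d v = 1], so the removed idempotent [e] is nonzero
    under [rho]. This strict drop makes repeated elimination terminate. *)
Lemma elimination_rank_lt :
  (\rank (map_mx rho (p' i0)) < \rank (map_mx rho (p i0)))%N.
Proof.
apply: (@mxrank_idem_lt _ _ _ _ (map_mx rho (e i0))); rewrite -map_mxM.
- by rewrite p'p.
- by rewrite mulmxBl pe ee subrr map_mx0.
rewrite pe /e eqxx; apply/eqP => e0.
have : map_mx rho (u *m (d i0 *m h) *m d i0 *m v) = 0.
  rewrite map_mxM [map_mx _ (_ *m d i0)]map_mxM [map_mx _ (u *m _)]map_mxM.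
  by rewrite e0 mulmx0 !mul0mx.
rewrite /h !mulmxA udv mul1mx udv map_mx1 => /matrixP/(_ 0 0)/eqP.
by rewrite !mxE eqxx oner_eq0.
Qed.

End Elimination.

(** Induction on the sum over the degrees from -N to N of the ranks of the terms under [rho]: as
    long as some [d] is nonzero under [rho], it has a unit entry and an elimination lowers the
    sum. *)
Lemma minimal_model (X : D) : exists n (p d : int -> 'M[A]_n) (H : is_cpx p d),
  isom X (cpx H) /\ forall i, map_mx rho (d i) = 0.
Proof.
have [n [p [d [H XH]]]] := cpx_model X.
have [N HN] := H.2.
have [m] := ubnP (\sum_(j < N.*2.+1) \rank (map_mx rho (p ((j : nat)%:Z - N%:Z)%R)))%N.
elim: m => // m IH in p d H XH HN * => rm.
have [dmin|] := pselect (forall i, map_mx rho (d i) = 0).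
  by exists n, p, d, H.
move=> /existsNP[i0 /eqP/unit_entry[u [v udv]]].
(* The vectors are cut down to [u p] and [p v], which lie in the terms of the complex and still pair
   to 1. *)
have up : u *m p i0 *m p i0 = u *m p i0 by rewrite -mulmxA (cpx_pp H).
have pv : p (i0 + 1) *m (p (i0 + 1) *m v) = p (i0 + 1) *m v.
  by rewrite mulmxA (cpx_pp H).
have {}udv : u *m p i0 *m d i0 *m (p (i0 + 1) *m v) = 1%:M.
  by rewrite -(mulmxA u) (cpx_pd H) mulmxA -(mulmxA u) (cpx_dp H).
(* Outside this range [p i0] is 0, whose rank cannot drop. *)
have i0N : (`|i0| <= N)%N.
  rewrite leqNgt; apply/negP => /HN pi0.
  have := elimination_rank_lt H up pv udv.
  by rewrite pi0 map_mx0 mxrank0.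
apply: (IH _ _ (elimination_subproof H up pv udv)).
- exact: (isom_trans XH (elimination_isom H up pv udv)).
- by move=> i /HN; exact: elimination_zero.
rewrite ltnS in rm; apply: leq_trans rm.
have lt : (`|(i0 + N%:Z)%R| < N.*2.+1)%N by lia.
rewrite (bigD1 (Ordinal lt)) //= [X in (_ < X)%N](bigD1 (Ordinal lt)) //=.
have -> : `|(i0 + N%:Z)%R|%N%:Z - N%:Z = i0 by lia.
rewrite -addSn leq_add ?elimination_rank_lt // leq_sum // => j _.
exact: elimination_rank.
Qed.

End LocalRing.

(* A local ring with residue field k whose maximal ideal is generated by an
   element eps with annihilator (eps). *)
Record dual_ring (A : comNzRingType) (k : fieldType) := DualRing {
  residue : {rmorphism A -> k};
  eps : A;
  residue_unit : forall a, residue a != 0 -> exists b, a * b = 1;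
  residue_ker : forall a, residue a = 0 -> exists b, a = eps * b;
  eps_sq : eps * eps = 0;
  eps_ann : forall a, eps * a = 0 -> residue a = 0 }.

(** * Objects concentrated in one degree *)

Section Concentrated.
Variables (A : comNzRingType) (k : fieldType) (W : dual_ring A k).
Local Notation rho := (residue W).
Local Notation eps := (eps W).
Local Notation D := (Dperf A).

Lemma rho_mx_ker n m (M : 'M[A]_(n, m)) :
  map_mx rho M = 0 -> exists M', M = eps *: M'.
Proof.
move=> /matrixP M0.
have /choice[f fE] : forall ij : 'I_n * 'I_m, exists b, M ij.1 ij.2 = eps * b.
  by move=> [i j]; apply: residue_ker; have := M0 i j; rewrite !mxE.
by exists (\matrix_(i, j) f (i, j)); apply/matrixP => i j; rewrite !mxE -fE.
Qed.

Lemma eps_mx_ann n m (M : 'M[A]_(n, m)) : eps *: M = 0 -> map_mx rho M = 0.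
Proof.
move=> /matrixP M0; apply/matrixP => i j; rewrite !mxE; apply: eps_ann.
by have := M0 i j; rewrite !mxE.
Qed.

Lemma eps_mulmx n m l (M : 'M[A]_(n, m)) (N : 'M[A]_(m, l)) :
  map_mx rho M = 0 -> M *m (eps *: N) = 0.
Proof.
by move=> /rho_mx_ker[M' ->]; rewrite -scalemxAl -scalemxAr scalerA eps_sq scale0r.
Qed.

Lemma mulmx_eps n m l (M : 'M[A]_(n, m)) (N : 'M[A]_(m, l)) :
  map_mx rho N = 0 -> (eps *: M) *m N = 0.
Proof.
by move=> /rho_mx_ker[N' ->]; rewrite -scalemxAl -scalemxAr scalerA eps_sq scale0r.
Qed.

(** An idempotent that vanishes under [rho] is a multiple of [eps], so its square, which is itself,
    is a multiple of [eps * eps = 0]. *)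
Lemma idem_rho_neq0 n (p : 'M[A]_n) : p *m p = p -> p != 0 -> map_mx rho p != 0.
Proof.
move=> pp; apply: contra => /eqP /[dup] p0 /rho_mx_ker[p' pE].
by rewrite -pp {2}pE eps_mulmx.
Qed.

(** Testing against maps to the shifts of A makes stability under isomorphisms and triangles
    immediate; by [concP] it means being isomorphic to a module in degree [a]. *)
Definition conc (a : int) (X : D) :=
  forall b, b != a -> forall f : mor X (unit_stalk A b), f = 0.

Lemma conc_isom a (X Y : D) : isom X Y -> conc a X -> conc a Y.
Proof.
move=> [f [g fg gf]] cX b ba h; rewrite -(comp1m h) -gf -compA.
by rewrite (cX b ba (f ;; h)) compm0.
Qed.

Lemma stalk_conc n a (p : 'M[A]_n) (pp : p *m p = p) : conc a (stalk a pp).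
Proof. by move=> b ba f; apply: stalk_hom0. Qed.

Section Minimal.
Variables (n : nat) (p d : int -> 'M[A]_n) (H : is_cpx p d).
Hypothesis dmin : forall i, map_mx rho (d i) = 0.

(** With no term in degree [a - 1], a coordinate function of the term in degree [a] is a chain map
    to A. A null-homotopy factors it through [d], so that it vanishes under [rho]. *)
Lemma minimal_hom_bottom a : p (a - 1) = 0 ->
  (forall f : mor (cpx H) (unit_stalk A a), f = 0) -> p a = 0.
Proof.
move=> pa1 X0; apply/eqP; apply: contraT => /(idem_rho_neq0 (cpx_pp H a)).
move=> /matrix0Pn[r [s]]; rewrite mxE; apply: contraNT => _; apply/eqP.
pose v : 'M[A]_(n, 1) := p a *m delta_mx s 0.
have fP : is_cmap (X := cpx H) (Y := unit_stalk A a) (at_degree a v).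
  move=> i; rewrite /= /at_degree mulmx0; split.
  - by case: eqP => [->|_]; rewrite ?mulmx0 // /v mulmxA (cpx_pp H).
  - by case: eqP => _; rewrite ?mulmx1 ?mulmx0.
  - case: eqP => [ia|_]; last by rewrite mulmx0.
    have -> : i = a - 1 by rewrite -ia addrK.
    by rewrite -(cpx_pd H) pa1 !mul0mx.
have /kmor_eq0/cpx_nullhomotopic[h hE] :=
  X0 (kmor (mk_cmap fP : cmap (cpx H) (unit_stalk A a))).
have := hE a; rewrite -[LHS]/(at_degree a v a) /at_degree eqxx mulmx0 addr0.
move=> /(congr1 (map_mx rho)); rewrite [in RHS]map_mxM dmin mul0mx => /matrixP/(_ r 0).
by rewrite !mxE (bigD1 s) //= big1 ?addr0 ?mxE ?eqxx ?mulr1 // => j js;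
  rewrite mxE (negbTE js) mulr0.
Qed.

(** [eps] times a coordinate function is a chain map because [eps] kills the minimal differential.
    With no term in degree [a + 1], null-homotopic means zero, and then the coordinate vanishes
    under [rho]. *)
Lemma minimal_hom_top a : p (a + 1) = 0 ->
  (forall f : mor (cpx H) (unit_stalk A a), f = 0) -> p a = 0.
Proof.
move=> pa1 X0; apply/eqP; apply: contraT => /(idem_rho_neq0 (cpx_pp H a)).
move=> /matrix0Pn[r [s]]; rewrite mxE; apply: contraNT => _; apply/eqP.
pose v : 'M[A]_(n, 1) := p a *m delta_mx s 0.
have fP : is_cmap (X := cpx H) (Y := unit_stalk A a) (at_degree a (eps *: v)).
  move=> i; rewrite /= /at_degree mulmx0; split.
  - by case: eqP => [->|_]; rewrite ?mulmx0 // -scalemxAr /v mulmxA (cpx_pp H).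
  - by case: eqP => _; rewrite ?mulmx1 ?mulmx0.
  - by case: eqP => [ia|_]; [rewrite eps_mulmx|rewrite mulmx0].
have /kmor_eq0/cpx_nullhomotopic[h hE] :=
  X0 (kmor (mk_cmap fP : cmap (cpx H) (unit_stalk A a))).
have := hE a; rewrite -[LHS]/(at_degree a (eps *: v) a) /at_degree eqxx mulmx0.
rewrite addr0 -(cpx_dp H) pa1 mulmx0 mul0mx => /eps_mx_ann/matrixP/(_ r 0).
by rewrite !mxE (bigD1 s) //= big1 ?addr0 ?mxE ?eqxx ?mulr1 // => j js;
  rewrite mxE (negbTE js) mulr0.
Qed.

(** The degrees below [a] are cleared upwards from -N by [minimal_hom_bottom], those above [a]
    downwards from N by [minimal_hom_top]. *)
Lemma minimal_conc a : conc a (cpx H) -> forall i, i != a -> p i = 0.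
Proof.
move=> ca; have [N HN] := H.2.
have low (m : nat) (i : int) : i <= m%:Z - N%:Z -> i < a -> p i = 0.
  elim: m i => [|m IH] i iN ia.
    have [iN'|iN'] := ltrP i (- N%:Z); first by rewrite HN //; lia.
    apply: minimal_hom_bottom; first by rewrite HN //; lia.
    by move=> f; apply: ca; lia.
  have [iN'|iN'] := lerP i (m%:Z - N%:Z); first exact: IH.
  apply: minimal_hom_bottom; first by apply: IH; lia.
  by move=> f; apply: ca; lia.
have high (m : nat) (i : int) : i >= N%:Z - m%:Z -> i > a -> p i = 0.
  elim: m i => [|m IH] i iN ia.
    have [iN'|iN'] := ltrP N%:Z i; first by rewrite HN //; lia.
    apply: minimal_hom_top; first by rewrite HN //; lia.
    by move=> f; apply: ca; lia.
  have [iN'|iN'] := lerP (N%:Z - m%:Z) i; first exact: IH.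
  apply: minimal_hom_top; first by apply: IH; lia.
  by move=> f; apply: ca; lia.
move=> i; rewrite neq_lt => /orP[ia|ia].
  by apply: (low (`|i| + N)%N) => //; lia.
by apply: (high (`|i| + N)%N) => //; lia.
Qed.

End Minimal.

Lemma cpx_stalk n (p d : int -> 'M[A]_n) (H : is_cpx p d) a :
  (forall i, i != a -> p i = 0) -> isom (cpx H) (stalk a (cpx_pp H a)).
Proof.
move=> pa; apply: cpx_isom => i.
  by rewrite /at_degree; have [->//|/pa] := eqVneq i a.
have [ia|/pa p0] := eqVneq i a; last by rewrite -(cpx_pd H) p0 mul0mx.
by rewrite -(cpx_dp H) pa ?mulmx0 // ia; lia.
Qed.

Lemma concP a (X : D) : conc a X <->
  exists n (p : 'M[A]_n) (pp : p *m p = p), isom X (stalk a pp).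
Proof.
split=> [cX|[n [p [pp /isom_sym Xp]]]]; last exact: conc_isom Xp (@stalk_conc _ a _ pp).
have [n [p [d [H [XH dmin]]]]] := minimal_model (residue_unit (d := W)) X.
exists n, (p a), (cpx_pp H a); apply: (isom_trans XH).
by apply: cpx_stalk; exact: minimal_conc dmin _ (conc_isom XH cX).
Qed.

Lemma zero_conc a (X : D) : is_zero X -> conc a X.
Proof. by move=> X0 b _ f; apply: zero_source. Qed.

Lemma conc_hom0 a b (X Y : D) : conc a X -> conc b Y -> a != b ->
  forall f : mor X Y, f = 0.
Proof.
move=> /concP[n [p [pp [i [i' ii' _]]]]] /concP[m [q [qq [j [j' jj' _]]]]] ab f.
have ij0 : i' ;; f ;; j = 0 by apply: stalk_hom0; rewrite eq_sym.
rewrite -(comp1m f) -(compm1 f) -ii' -jj' -compA (compA f) (compA i').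
by rewrite (compA i') ij0 comp0m compm0.
Qed.

Lemma unit_stalk_neq0 a : ~ is_zero (unit_stalk A a).
Proof.
move=> /stalk_zeroP /matrixP/(_ 0 0); rewrite !mxE eqxx => /eqP.
by rewrite oner_eq0.
Qed.

Lemma conc_susp a (X : D) : conc a X -> conc (a - 1) (susp X).
Proof.
move=> /concP[n [p [pp Xp]]]; apply/concP; exists n, p, pp.
exact: isom_trans (isom_susp Xp) (susp_stalk _ _).
Qed.

Lemma conc_distinguished a (X Y Z : D) :
  is_distinguished X Y Z -> conc a X -> conc a Z -> conc a Y.
Proof.
by move=> t cX cZ b ba; apply: (distinguished_hom0 t) => f; [apply: cX|apply: cZ].
Qed.

(** A unit entry of [p] gives vectors with [u p v = 1], and the idempotent [p v u p] cuts out a free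
    summand of rank one. Iterated, this is the freeness of projective modules over a local ring. *)
Lemma stalk_split n a (p : 'M[A]_n) (pp : p *m p = p) : p != 0 ->
  exists (q : 'M[A]_n) (qq : q *m q = q),
  [/\ (\rank (map_mx rho q) < \rank (map_mx rho p))%N,
      is_biprod (unit_stalk A a) (stalk a qq) (stalk a pp)
    & is_distinguished (unit_stalk A a) (stalk a pp) (stalk a qq)].
Proof.
move=> /(idem_rho_neq0 pp)/(unit_entry (residue_unit (d := W)))[u [v uv]].
pose e := p *m v *m (u *m p).
have upv : u *m p *m (p *m v) = 1%:M by rewrite mulmxA -(mulmxA u) pp.
have ee : e *m e = e by rewrite /e mulmxA -(mulmxA (p *m v)) upv mulmx1.
have ep : e *m p = e by rewrite /e -!mulmxA pp.
have pe : p *m e = e by rewrite /e !mulmxA pp.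
have qq : (p - e) *m (p - e) = p - e.
  by rewrite mulmxBr !mulmxBl pp ep pe ee subrr subr0.
have eE : isom (stalk a ee) (unit_stalk A a).
  by apply: (@stalk_isom _ _ _ _ _ _ _ _ (p *m v) (u *m p)).
exists (p - e), qq; split.
- apply: (@mxrank_idem_lt _ _ _ _ (map_mx rho e)); rewrite -map_mxM.
  + by rewrite mulmxBl pp ep.
  + by rewrite mulmxBl pe ee subrr map_mx0.
  rewrite pe; apply/eqP => e0.
  have : map_mx rho (u *m p *m e *m (p *m v)) = 0.
    by rewrite map_mxM [map_mx _ (_ *m e)]map_mxM e0 mulmx0 mul0mx.
  rewrite /e (mulmxA (u *m p) (p *m v)) upv mul1mx upv map_mx1 => /matrixP/(_ 0 0)/eqP.
  by rewrite !mxE eqxx oner_eq0.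
- apply: biprod_isom eE.
  by apply: stalk_split_biprod; rewrite ?mulmxBl ?mulmxBr ?ep ?pe ?ee ?subrr //
    addrC subrK.
- apply: (distinguished_isom _ eE (isom_refl _) (isom_refl _)).
  by apply: stalk_split_distinguished; rewrite ?mulmxBl ?mulmxBr ?ep ?pe ?ee ?subrr //
    addrC subrK.
Qed.

(** Induction on the rank under [rho], splitting off one copy of A at a time. The closure step
    offers the splitting as a biproduct, used for co-slicings, and as a triangle, used for K_0. *)
Lemma conc_ind a (C : set D) : iso_closed C -> (forall X, is_zero X -> C X) ->
  (forall X Y Z, is_biprod X Y Z -> is_distinguished X Z Y -> C X -> C Y -> C Z) ->
  C (unit_stalk A a) -> forall X, conc a X -> C X.
Proof.
move=> Ciso C0 CD CA X /concP[n [p [pp Xp]]]; apply: Ciso (isom_sym Xp) _ => {X Xp}.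
have [m] := ubnP (\rank (map_mx rho p)); elim: m => // m IH in p pp *.
rewrite ltnS => rm; have [p0|p0] := eqVneq p 0; first by apply/C0/stalk_zeroP.
have [q [qq [rq bq dq]]] := stalk_split a pp p0.
by apply: CD bq dq CA (IH _ _ _); apply: leq_trans rm.
Qed.

Lemma conc_split a (X : D) : conc a X -> ~ is_zero X ->
  exists2 Y : D, conc a Y & is_biprod (unit_stalk A a) Y X.
Proof.
move=> /concP[n [p [pp Xp]]] X0.
have p0 : p != 0.
  by apply/eqP => p0; apply: X0; apply: (isom_zero (isom_sym Xp)); apply/stalk_zeroP.
have [q [qq [_ bq _]]] := stalk_split a pp p0; exists (stalk a qq).
  exact: stalk_conc.
exact: biprod_isom_total bq (isom_sym Xp).
Qed.

Lemma conc_retract a (X : D) : conc a X -> ~ is_zero X ->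
  retract (unit_stalk A a) X.
Proof. by move=> cX X0; have [Y _ /biprod_retract] := conc_split cX X0. Qed.

Lemma conc_inj a b (X : D) : conc a X -> conc b X -> ~ is_zero X -> a = b.
Proof.
move=> ca cb X0; have [s [r sr]] := conc_retract ca X0.
apply/eqP; apply: contraT => ab; exfalso; apply: (@unit_stalk_neq0 a).
by rewrite /is_zero -sr (cb a ab r) compm0.
Qed.

End Concentrated.

(** * Slicings and co-slicings *)

Section SelfExtensions.
Variables (A : comNzRingType) (k : fieldType) (W : dual_ring A k).
Local Notation rho := (residue W).
Local Notation eps := (eps W).
Local Notation D := (Dperf A).

Lemma mulmx_delta_neq0 (F : fieldType) n m (P : 'M[F]_n) (Q : 'M[F]_m) :
  P != 0 -> Q != 0 -> exists s t, P *m delta_mx s t *m Q != 0.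
Proof.
move=> /matrix0Pn[r [s Prs]] /matrix0Pn[t [l Qtl]]; exists s, t.
apply/matrix0Pn; exists r, l; rewrite !mxE (bigD1 t) //=.
rewrite big1 ?addr0 => [|j jt]; last first.
  rewrite mxE big1 ?mul0r // => i _.
  by rewrite mxE (negbTE jt) andbF mulr0.
rewrite mxE (bigD1 s) //= big1 => [|i si]; last by rewrite mxE (negbTE si) mulr0.
by rewrite mxE !eqxx mulr1 addr0 mulf_neq0.
Qed.

Lemma cpx_extremal_degrees n (p d : int -> 'M[A]_n) (H : is_cpx p d) i0 :
  p i0 != 0 -> exists (lo : int) (m : nat),
    [/\ p lo != 0, p (lo + m%:Z) != 0, forall i, i < lo -> p i = 0
      & forall i, lo + m%:Z < i -> p i = 0].
Proof.
move=> pi0; have [N HN] := H.2.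
pose P (j : nat) := p (j%:Z - N%:Z) != 0.
have PE (i : int) : p i != 0 -> exists2 j : nat, i = j%:Z - N%:Z & P j.
  move=> pi; have iN : (`|i| <= N)%N.
    by rewrite leqNgt; apply/negP => /HN p0; rewrite p0 eqxx in pi.
  exists `|(i + N%:Z)%R|%N; last rewrite /P; have -> : `|(i + N%:Z)%R|%N%:Z - N%:Z = i by lia.
    by [].
  by [].
have exP : exists j, P j by have [j _ Pj] := PE _ pi0; exists j.
have ubP j : P j -> (j <= N.*2)%N.
  by rewrite /P leqNgt; apply: contra => Nj; rewrite HN //; lia.
case: (ex_minnP exP) => lo Plo lomin; case: (ex_maxnP exP ubP) => hi Phi himax.
have lohi := lomin _ Phi.
have E : lo%:Z - N%:Z + (hi - lo)%N%:Z = hi%:Z - N%:Z by lia.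
exists (lo%:Z - N%:Z), (hi - lo)%N; rewrite E; split=> //.
- move=> i ilo; apply/eqP; apply: contraT => /PE[j ij /lomin]; lia.
- move=> i ihi; apply/eqP; apply: contraT => /PE[j ij /himax]; lia.
Qed.

Section Extremal.
Variables (n : nat) (p d d' : int -> 'M[A]_n) (m : nat) (lo : int).
Variables (H : is_cpx p d) (H' : is_cpx (fun i => p (i + m%:Z)) d').
Hypotheses (dmin : forall i, map_mx rho (d i) = 0).
Hypotheses (dmin' : forall i, map_mx rho (d' i) = 0).
Hypotheses (plo : p lo != 0) (phi : p (lo + m%:Z) != 0).
Hypotheses (below : forall i, i < lo -> p i = 0).
Hypotheses (above : forall i, lo + m%:Z < i -> p i = 0).

(* Any map from the lowest term of X to its highest term is a chain map
   X -> Sigma^m X, and it is null-homotopic only if it vanishes modulo eps. *)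
Lemma minimal_self_extension : exists f : mor (cpx H) (cpx H'), f <> 0.
Proof.
have [s [t Mst]] := mulmx_delta_neq0 (idem_rho_neq0 W (cpx_pp H _) plo)
  (idem_rho_neq0 W (cpx_pp H _) phi).
pose M := p lo *m delta_mx s t *m p (lo + m%:Z).
have fP : is_cmap (X := cpx H) (Y := cpx H') (at_degree lo M).
  move=> i; rewrite /= /at_degree; split.
  - by case: eqP => [->|_]; rewrite ?mulmx0 // /M !mulmxA (cpx_pp H).
  - by case: eqP => [->|_]; rewrite ?mul0mx // /M -[LHS]mulmxA (cpx_pp H).
  - have -> : d i *m (if i + 1 == lo then M else 0) = 0.
      case: eqP => [ilo|_]; last by rewrite mulmx0.
      by rewrite -(cpx_pd H) below ?mul0mx //; lia.
    case: eqP => [->|_]; last by rewrite mul0mx.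
    by rewrite -(cpx_dp H') above ?mulmx0 //; lia.
exists (kmor (mk_cmap fP : cmap (cpx H) (cpx H'))) => /kmor_eq0.
move=> /cpx_nullhomotopic[h /(_ lo)].
rewrite -[LHS]/(at_degree lo M lo) /at_degree eqxx => /(congr1 (map_mx rho)).
rewrite [in RHS]map_mxD !map_mxM dmin dmin' mul0mx mulmx0 addr0 map_delta_mx.
by move=> M0; rewrite M0 eqxx in Mst.
Qed.

(** The factor [eps] makes any map from the highest term to the lowest a chain map. No differential
    leaves the highest term or enters the lowest, so null-homotopic means [eps *: M = 0], and then
    [M] vanishes under [rho]. *)
Lemma minimal_self_coextension : exists f : mor (cpx H') (cpx H), f <> 0.
Proof.
have [s [t Mst]] := mulmx_delta_neq0 (idem_rho_neq0 W (cpx_pp H _) phi)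
  (idem_rho_neq0 W (cpx_pp H _) plo).
pose M := p (lo + m%:Z) *m delta_mx s t *m p lo.
have fP : is_cmap (X := cpx H') (Y := cpx H) (at_degree lo (eps *: M)).
  move=> i; rewrite /= /at_degree; split.
  - case: eqP => [->|_]; rewrite ?mulmx0 // -scalemxAr /M !mulmxA.
    by rewrite (cpx_pp H).
  - case: eqP => [->|_]; rewrite ?mul0mx // -scalemxAl /M.
    by rewrite -[_ *m p lo *m p lo]mulmxA (cpx_pp H).
  - have -> : d' i *m (if i + 1 == lo then eps *: M else 0) = 0.
      by case: eqP => _; rewrite ?mulmx0 // eps_mulmx.
    by case: eqP => _; rewrite ?mul0mx // mulmx_eps.
exists (kmor (mk_cmap fP : cmap (cpx H') (cpx H))) => /kmor_eq0.
move=> /cpx_nullhomotopic[h /(_ lo)].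
rewrite -[LHS]/(at_degree lo (eps *: M) lo) /at_degree eqxx.
rewrite -(cpx_dp H') above; last by lia.
rewrite -(cpx_pd H) below; last by lia.
rewrite mulmx0 !mul0mx mulmx0 addr0 => /eps_mx_ann.
by rewrite !map_mxM map_delta_mx => M0; rewrite M0 eqxx in Mst.
Qed.

End Extremal.
End SelfExtensions.

(** * Objects with a phase live in one degree *)

Section SliceStructure.
Variables (R : realType) (A : comNzRingType) (k : fieldType) (W : dual_ring A k).
Local Notation rho := (residue W).
Local Notation D := (Dperf A).
Implicit Types P : R -> set D.

(** Brings iterated suspensions back to complexes with terms [p (i + m)], the form in which
    self-extensions are computed. The differential changes only by index and sign, so it stays
    minimal. *)
Lemma susp_family P n (p d : int -> 'M[A]_n) (H : is_cpx p d) phi :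
  (forall phi, P (phi + 1) = susp_of (P phi)) -> (forall phi, iso_closed (P phi)) ->
  (forall i, map_mx rho (d i) = 0) -> P phi (cpx H) ->
  forall m : nat, exists d' (H' : is_cpx (fun i => p (i + m%:Z)) d'),
    P (phi + m%:R) (cpx H') /\ forall i, map_mx rho (d' i) = 0.
Proof.
move=> Psusp Piso dmin PH; elim=> [|m [d' [H' [PH' dmin']]]].
  rewrite addr0; exists d.
  suff -> : (fun i => p (i + 0%:Z)) = p by exists H.
  by apply: funext => i; rewrite addr0.
exists (fun i => - d' (i + 1)).
have -> : (fun i => p (i + m.+1%:Z)) = (fun i => p (i + 1 + m%:Z)).
  by apply: funext => i; congr p; lia.
exists (susp_cpx_subproof H'); split=> [|i]; last by rewrite map_mxN dmin' oppr0.
apply: Piso (susp_cpx H') _; rewrite -natr1 addrA Psusp.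
by exists (cpx H') => //; exact: isom_refl.
Qed.

Lemma minimal_single_degree n (p d : int -> 'M[A]_n) (H : is_cpx p d) (X : D) :
  isom X (cpx H) -> ~ is_zero X ->
  (forall (lo : int) (m : nat), p lo != 0 -> p (lo + m%:Z) != 0 ->
    (forall i, i < lo -> p i = 0) -> (forall i, lo + m%:Z < i -> p i = 0) ->
    m = 0%N) -> exists a, conc a X.
Proof.
move=> XH X0 H0.
have [i0 pi0] : exists i, p i != 0.
  apply: contrapT => /forallNP p0; apply: X0; apply: (isom_zero (isom_sym XH)).
  apply/kmor_eq0; rewrite (_ : cmap_id _ = 0); first exact: nullhomotopic0.
  by apply: cmap_inj => i; apply/eqP; have /negP := p0 i; rewrite negbK.
have [lo [m [plo phi below above]]] := cpx_extremal_degrees H pi0.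
have m0 := H0 _ _ plo phi below above; exists lo.
apply: conc_isom (isom_sym XH) _; apply: conc_isom (isom_sym (cpx_stalk H _)) _.
  move=> i; rewrite neq_lt => /orP[/below //|ilo].
  by apply: above; rewrite m0 addr0.
exact: (@stalk_conc _ _ lo).
Qed.

(** If the extremal degrees differ by [m > 0], [minimal_self_extension] is a nonzero map from phase
    [phi] to phase [phi + m], which a co-slicing forbids. *)
Lemma coslicing_conc P : is_coslicing P -> forall phi X, P phi X -> ~ is_zero X ->
  exists a, conc a X.
Proof.
move=> [P1 P2 P3 P4] phi X PX X0.
have Piso psi : iso_closed (P psi).
  by apply: sum_closed_iso (zero_object_exists A) (P1 psi).1.
have [n [p [d [H [XH dmin]]]]] := minimal_model (residue_unit (d := W)) X.
apply: (minimal_single_degree XH X0) => lo m plo phi' below above.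
apply/eqP; rewrite -leqn0 leqNgt; apply/negP => m0.
have [d' [H' [PH' dmin']]] := susp_family P2 Piso dmin (Piso _ _ _ XH PX) m.
have [f] := minimal_self_extension H H' dmin dmin' plo phi' below above.
apply; apply: (P3 phi (phi + m%:R)) PH' => //; first by rewrite ltrDl ltr0n.
exact: Piso XH PX.
Qed.

(** Here the forbidden map is [minimal_self_coextension], from phase [phi + m] to phase [phi]. *)
Lemma slicing_conc P : is_slicing P -> forall phi X, P phi X -> ~ is_zero X ->
  exists a, conc a X.
Proof.
move=> [P1 P2 P3 P4] phi X PX X0.
have Piso psi : iso_closed (P psi) by exact: (P1 psi).1.
have [n [p [d [H [XH dmin]]]]] := minimal_model (residue_unit (d := W)) X.
apply: (minimal_single_degree XH X0) => lo m plo phi' below above.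
apply/eqP; rewrite -leqn0 leqNgt; apply/negP => m0.
have [d' [H' [PH' dmin']]] := susp_family P2 Piso dmin (Piso _ _ _ XH PX) m.
have [f] := minimal_self_coextension H H' dmin dmin' plo phi' below above.
apply; apply: (P3 (phi + m%:R) phi) => //; first by rewrite ltrDl ltr0n.
exact: Piso XH PX.
Qed.

End SliceStructure.

Section Filtrations.
Variables (R : realType) (A : comNzRingType).
Local Notation D := (Dperf A).

Lemma distinguished_zero (X Y Z : D) :
  is_distinguished X Y Z -> is_zero X -> is_zero Z -> is_zero Y.
Proof.
by move=> t X0 Z0; apply: (distinguished_hom0 t) => f; apply: zero_source.
Qed.

Lemma filtration_factor (lt : R -> R -> Prop) (P : R -> set D) (X : D) :
  ~ is_zero X -> has_filtration lt P X ->
  exists phi Y, P phi Y /\ ~ is_zero Y.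
Proof.
move=> X0 [n [E [F [phi [n0 [E0 En] tr PF _]]]]]; apply: contrapT => PZ; apply: X0.
have F0 i : (i < n)%N -> is_zero (F i).
  by move=> ni; apply: contrapT => Fi; apply: PZ; exists (phi i), (F i); split=> //; apply: PF.
apply: (isom_zero En); have : (n <= n)%N by [].
elim: {1 3}n => // i IH ni.
by apply: distinguished_zero (tr _ ni) (IH (ltnW ni)) (F0 _ ni).
Qed.

End Filtrations.

(** * Classification of the co-slicings *)

Section StandardCoslicing.
Variables (R : realType) (A : comNzRingType) (k : fieldType) (W : dual_ring A k).
Local Notation D := (Dperf A).
Local Notation S := (unit_stalk A).

(* The j-th suspension of A has phase b + j and lives in degree - j. *)
Definition std_coslicing (b phi : R) : set D :=
  [set X | forall a : int, phi <> b - a%:~R -> forall f : mor X (S a), f = 0].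

Lemma phase_inj (b : R) (a a' : int) : b - a%:~R = b - a'%:~R -> a = a'.
Proof. by move=> /addrI/oppr_inj/eqP; rewrite eqr_int => /eqP. Qed.

(** When [phi] is not of the form [b - a], an object has no maps to any [S a]; it is then
    concentrated both in degree 0 and in degree 1, hence zero. *)
Lemma std_coslicingP b phi X : std_coslicing b phi X <->
  is_zero X \/ exists2 a : int, phi = b - a%:~R & conc a X.
Proof.
split=> [QX|[X0 a _ f|[a -> cX] a' aa' f]]; last 2 first.
- exact: zero_source.
- by apply: cX; apply/eqP => e; apply: aa'; rewrite e.
have [[a pa]|npa] := pselect (exists a : int, phi = b - a%:~R).
  right; exists a => // a' aa' f; apply: QX; rewrite pa => /phase_inj e.
  by rewrite e eqxx in aa'.
left; apply: contrapT => X0.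
have cX a : conc a X by move=> a' _; apply: QX => e; apply: npa; exists a'.
by have := conc_inj W (cX 0) (cX 1) X0.
Qed.

Lemma std_coslicing_is_coslicing b : is_coslicing (std_coslicing b).
Proof.
split.
- move=> phi; split.
    split=> [X X0 a _ f|X Y Z [i1 [i2 [p1 [p2 [_ _ _ _ E]]]]] QX QY a pa f].
      exact: zero_source.
    rewrite -(comp1m f) -E compDl -!compA (QX a pa (i1 ;; f)) (QY a pa (i2 ;; f)).
    by rewrite !compm0 addr0.
  move=> X Y Z [i1 [i2 [p1 [p2 [E _ _ _ _]]]]] QZ a pa f.
  by rewrite -(comp1m f) -E -compA (QZ a pa (p1 ;; f)) compm0.
- move=> phi; apply/seteqP; split=> X.
    move=> /std_coslicingP[X0|[a pa /(concP W)[n [p [pp Xp]]]]].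
      exists X; first by apply/std_coslicingP; left.
      by apply: zero_isom => //; exact: susp_zero.
    exists (stalk (a + 1) pp).
      apply/std_coslicingP; right; exists (a + 1); last exact: (@stalk_conc _ _ (a + 1)).
      by rewrite rmorphD /= opprD addrA -pa addrK.
    apply: (isom_trans Xp); apply: isom_sym.
    by apply: (isom_trans (susp_stalk _ _)); rewrite addrK; exact: isom_refl.
  move=> [Y /std_coslicingP[Y0|[a pa cY]] /isom_sym XY]; apply/std_coslicingP.
    by left; apply: (isom_zero XY); exact: susp_zero.
  right; exists (a - 1); last exact: conc_isom XY (conc_susp W cY).
  by rewrite rmorphB /= opprB addrCA addrC pa.
- move=> phi1 phi2 lt X Y f /std_coslicingP[X0|[a pa cX]].
    by move=> _; exact: zero_source.
  move=> /std_coslicingP[Y0|[a' pa' cY]]; first exact: zero_target.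
  apply: (conc_hom0 W cX cY); apply/eqP => aa'.
  by rewrite pa pa' aa' ltxx in lt.
(* The brutal truncations list the degrees in decreasing order, hence the phases in increasing
   order. *)
- move=> X _; have [n [N [p [pp [E [E0 EN tr]]]]]] := stalk_filtration X.
  exists N.*2.+1, E, (fun i => stalk (N%:Z - i%:Z) (pp (N%:Z - i%:Z))).
  exists (fun i => b - (N%:Z - i%:Z)%:~R); split=> //.
    move=> i _; apply/std_coslicingP; right; exists (N%:Z - i%:Z) => //.
    exact: (@stalk_conc _ _ (N%:Z - i%:Z)).
  move=> i j /andP[ij _]; rewrite ltrD2l ltrN2 ltr_int; lia.
Qed.

(** An indecomposable object in degree [a] has [S a] as a summand, hence is isomorphic to it, so a
    phase has at most one indecomposable object up to isomorphism. *)
Lemma std_coslicing_S b : condition_S (std_coslicing b).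
Proof.
move=> phi X Y [X0 indX] [Y0 indY] QX QY nXY f; exfalso; apply: nXY.
move: QX QY => /std_coslicingP[//|[a pa cX]] /std_coslicingP[//|[a' pa' cY]].
have aa' : a = a' by apply: (@phase_inj b); rewrite -pa -pa'.
rewrite -{}aa' {a' pa'} in cY.
suff S_isom (Z : D) : ~ is_zero Z -> conc a Z ->
    (forall Y1 Y2, is_biprod Y1 Y2 Z -> is_zero Y1 \/ is_zero Y2) -> isom (S a) Z.
  exact: isom_trans (isom_sym (S_isom X X0 cX indX)) (S_isom Y Y0 cY indY).
move=> Z0 cZ indZ; have [Z' _ bZ] := conc_split W cZ Z0.
by have [/unit_stalk_neq0|] := indZ _ _ bZ; last exact: biprod_zero_isom bZ.
Qed.

Definition std_coslice (b : R) : coslice R D :=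
  Coslice (std_coslicing_is_coslicing b) (@std_coslicing_S b).

Lemma coslice_eq (Q Q' : coslice R D) : Q = Q' :> (R -> set D) -> Q = Q'.
Proof.
case: Q Q' => [q c s] [q' c' s'] /= qq'; move: c s; rewrite qq' => c s.
by congr Coslice; exact: Prop_irrelevance.
Qed.

Section Classification.
Variables (Q : R -> set D) (cQ : is_coslicing Q).

Let Q_iso phi : iso_closed (Q phi).
Proof.
have [Q1 _ _ _] := cQ.
by apply: sum_closed_iso (zero_object_exists A) (Q1 phi).1.
Qed.

Let Q_unit phi X : Q phi X -> ~ is_zero X -> exists2 a, conc a X & Q phi (S a).
Proof.
have [Q1 _ _ _] := cQ.
move=> QX X0; have [a cX] := coslicing_conc W cQ QX X0; exists a => //.
have [Y _ bY] := conc_split W cX X0; exact: (Q1 phi).2 bY QX.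
Qed.

Let Q_susp phi a (m : nat) : Q phi (S a) -> Q (phi + m%:R) (S (a - m%:Z)).
Proof.
have [_ Q2 _ _] := cQ.
move=> QS; elim: m => [|m IH]; first by rewrite addr0 subr0.
rewrite -natr1 addrA Q2; exists (S (a - m%:Z)) => //.
have -> : a - m.+1%:Z = a - m%:Z - 1 by lia.
exact: isom_sym (susp_stalk _ _).
Qed.

Let Q_phase_eq phi psi a : Q phi (S a) -> Q psi (S a) -> phi = psi.
Proof.
have [_ _ Q3 _] := cQ; move=> Q1 Q2; apply/eqP; apply: contraT.
rewrite neq_lt => /orP[lt|lt]; exfalso; apply: (@unit_stalk_neq0 A a).
  exact: (Q3 _ _ lt _ _ (idm (S a))).
exact: (Q3 _ _ lt _ _ (idm (S a))).
Qed.

(** Suspending the object of higher degree brings both into the same degree, where [Q_phase_eq]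
    applies. *)
Let Q_phase phi psi a a' :
  Q phi (S a) -> Q psi (S a') -> phi + a%:~R = psi + a'%:~R.
Proof.
wlog aa' : phi psi a a' / a' <= a.
  move=> H Qa Qa'; have [|/ltW] := lerP a' a; first by move=> /H; apply.
  by move=> /H /(_ Qa' Qa) ->.
move=> /(Q_susp `|a - a'|%N); have -> : a - `|a - a'|%N%:Z = a' by lia.
move=> /Q_phase_eq H /H <-; rewrite -addrA; congr (_ + _).
by rewrite -[_%:R]/(_%:Z%:~R) -rmorphD /=; congr (_%:~R); lia.
Qed.

(** The axiom only yields some [Y] of phase [phi - 1] whose suspension is [S a]; [Y] contains some
    [S c], and comparing phases forces [c = a + 1]. *)
Let Q_desusp phi a : Q phi (S a) -> Q (phi - 1) (S (a + 1)).
Proof.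
have [_ Q2 _ _] := cQ; move=> QS; have := QS.
rewrite -{1}(subrK 1 phi) Q2 => -[Y QY SY].
have Y0 : ~ is_zero Y.
  move=> Y0; apply: (@unit_stalk_neq0 A a); apply: (isom_zero (isom_sym SY)).
  exact: susp_zero.
have [c _ QSc] := Q_unit QY Y0.
have /eqP := Q_phase QSc QS; rewrite -addrA (inj_eq (addrI phi)) addrC.
rewrite -[1]/(1%:~R) -rmorphB eqr_int subr_eq => /eqP <- //.
Qed.

(** A nonzero factor in a filtration of A puts one [S a0] into a phase. Suspending and desuspending
    places every [S a], and these determine all phases. *)
Lemma coslicing_std : exists b, Q = std_coslicing b.
Proof.
have [Q1 Q2 Q3 Q4] := cQ.
have [phi [X [QX X0]]] := filtration_factor (@unit_stalk_neq0 A 0) (Q4 _ (@unit_stalk_neq0 A 0)).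
have [a0 _ Qa0] := Q_unit QX X0; pose b := phi + a0%:~R.
have Q_all a : Q (b - a%:~R) (S a).
  have [aa0|aa0] := lerP a a0.
    have := Q_susp `|a0 - a|%N Qa0; have -> : a0 - `|a0 - a|%N%:Z = a by lia.
    congr (Q _ _); rewrite /b -addrA; congr (_ + _).
    by rewrite -[_%:R]/(_%:Z%:~R) -rmorphB /=; congr (_%:~R); lia.
  have -> : a = a0 + `|a - a0|%N%:Z by lia.
  elim: (`|a - a0|%N) => [|m IH]; first by rewrite addr0 /b addrK.
  have -> : a0 + m.+1%:Z = a0 + m%:Z + 1 by lia.
  by rewrite rmorphD /= opprD addrA; exact: Q_desusp.
exists b; apply/funext => psi; apply/seteqP; split=> Y.
  move=> QY; apply/std_coslicingP; have [|Y0] := pselect (is_zero Y); first by left.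
  right; have [a cY Qa] := Q_unit QY Y0; exists a => //.
  exact: Q_phase_eq Qa (Q_all a).
move=> /std_coslicingP[Y0|[a -> cY]]; first exact: (Q1 psi).1.1.
apply: (conc_ind W (@Q_iso _) _ _ _ cY) => //; first exact: (Q1 _).1.1.
by move=> X1 X2 X3 bX _; exact: (Q1 _).1.2 bX.
Qed.

End Classification.
End StandardCoslicing.

(** * Nonexistence of slicings *)

Section NoSlicing.
Variables (R : realType) (A : comNzRingType) (k : fieldType) (W : dual_ring A k).
Local Notation D := (Dperf A).
Local Notation S := (unit_stalk A).
Local Notation rho := (residue W).
Local Notation eps := (eps W).

Lemma residue_eps : rho eps = 0.
Proof. exact/eps_ann/eps_sq. Qed.

Definition koszul_pr (i : int) : 'M[A]_1 := if (i == 0) || (i == 1) then 1%:M else 0.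
Definition koszul_df (i : int) : 'M[A]_1 := if i == 0 then eps%:M else 0.

Fact koszul_subproof : is_cpx koszul_pr koszul_df.
Proof.
rewrite /koszul_pr /koszul_df; split=> [i|]; last first.
  by exists 1%N => i i1; case: ifP => // /orP[/eqP|/eqP] ii; rewrite ii in i1.
have [->|i0] := eqVneq i 0.
  by rewrite /= !mulmx1 mul1mx mulmx0.
rewrite mulmx0 !mul0mx; split=> //.
by case: ifP; rewrite ?mulmx1 ?mulmx0.
Qed.

Definition koszul : D := cpx koszul_subproof.

Lemma koszul_neq0 : ~ is_zero koszul.
Proof.
move=> /kmor_eq0/cpx_nullhomotopic[h /(_ 0)].
rewrite -[LHS]/(1%:M : 'M[A]_1) /koszul_df /= mulmx0 addr0 => /matrixP/(_ 0 0).
rewrite mul_scalar_mx !mxE eqxx => /(congr1 rho).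
by rewrite rmorph1 rmorphM residue_eps mul0r => /eqP; rewrite oner_eq0.
Qed.

(** A splitting gives matrices of size one in degree [a] with product 1. In degree 0 [eps] kills the
    section, in degree 1 it kills the retraction, and elsewhere the complex is 0; in each case one
    factor vanishes under [rho]. *)
Lemma koszul_no_retract a : ~ retract (S a) koszul.
Proof.
move=> [s [r]]; have [s' ->] := kmor_repr s; have [r' ->] := kmor_repr r.
rewrite kmor_comp => /kclassP/stalk_nullhomotopic.
rewrite -[LHS]/(s' a *m r' a - at_degree a 1%:M a) /at_degree eqxx => /eqP.
rewrite subr_eq0 => /eqP sr1.
have [_ s2 s3] := cmapE s' a; have [_ _ r3] := cmapE r' (a - 1).
have sr (M N : 'M[A]_1) : M *m N = 1%:M -> rho (M 0 0) * rho (N 0 0) = 1.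
  move=> /matrixP/(_ 0 0); rewrite !mxE big_ord1 eqxx => /(congr1 rho).
  by rewrite rmorphM rmorph1.
have {}sr1 := sr _ _ sr1; move/eqP: sr1; apply/negP.
have [a0|a0] := eqVneq a 0.
  subst a; move: s3; rewrite /= mul0mx /koszul_df /= mul_mx_scalar.
  by move=> /eps_mx_ann/matrixP/(_ 0 0); rewrite !mxE => ->; rewrite mul0r eq_sym oner_eq0.
have [a1|a1] := eqVneq a 1.
  subst a; move: r3; rewrite -[r' (1 - 1 + 1)]/(r' 1) /= mulmx0 /koszul_df /=.
  rewrite mul_scalar_mx => /esym.
  by move=> /eps_mx_ann/matrixP/(_ 0 0); rewrite !mxE => ->; rewrite mulr0 eq_sym oner_eq0.
move: s2; rewrite /= /koszul_pr (negbTE a0) (negbTE a1) /= mulmx0 => <-.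
by rewrite mxE rmorph0 mul0r eq_sym oner_eq0.
Qed.

Section Slicing.
Variables (P : R -> set D) (cP : is_slicing P).

Let P_susp phi X (m : nat) : P phi X -> P (phi + m%:R) (iter m (@susp D) X).
Proof.
have [_ P2 _ _] := cP; move=> PX; elim: m => [|m IH]; first by rewrite addr0.
by rewrite -natr1 addrA P2; exists (iter m (@susp D) X) => //; exact: isom_refl.
Qed.

Let retract_iter_susp a X (m : nat) :
  retract (S a) X -> retract (S (a - m%:Z)) (iter m (@susp D) X).
Proof.
move=> aX; elim: m => [|m IH]; first by rewrite subr0.
have -> : a - m.+1%:Z = a - m%:Z - 1 by lia.
exact: retract_isom (susp_stalk _ _) (retract_susp IH).
Qed.

(** If [a' <= a], then [X] suspended [a - a'] times still has larger phase than [Y], and both have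
    [S a'] as a retract, which would make [S a'] zero. *)
Lemma slicing_order phi psi a a' X Y : P phi X -> P psi Y -> conc a X -> conc a' Y ->
  ~ is_zero X -> ~ is_zero Y -> psi < phi -> a < a'.
Proof.
have [_ _ P3 _] := cP; move=> PX PY cX cY X0 Y0 lt.
rewrite ltNge; apply/negP => aa'; pose m := `|a - a'|%N.
have PX' := P_susp m PX.
have aX' := retract_iter_susp m (conc_retract W cX X0).
have am : a - m%:Z = a' by rewrite /m; lia.
rewrite am in aX'; apply: (@unit_stalk_neq0 A a').
apply: retract_hom_vanish (P3 _ _ _) PX' PY aX' (conc_retract W cY Y0).
by apply: lt_le_trans lt _; rewrite lerDl ler0n.
Qed.

(** The invariant is a retract of [E m] whose degree lies below those of all later nonzero factors;
    it starts at the first nonzero factor and survives to the end. *)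
Lemma no_slicing_aux (n : nat) (E F : nat -> D) (phi : nat -> R) :
  is_zero (E 0%N) ->
  (forall i, (i < n)%N -> is_distinguished (E i) (E i.+1) (F i)) ->
  (forall i, (i < n)%N -> P (phi i) (F i)) ->
  (forall i j, (i < j < n)%N -> phi i > phi j) ->
  forall m, (m <= n)%N -> is_zero (E m) \/
    exists2 a, retract (S a) (E m) &
      forall j a', (m <= j < n)%N -> conc a' (F j) -> ~ is_zero (F j) -> a < a'.
Proof.
move=> E0 tr PF dphi; elim=> [|m IH] mn; first by left.
have [Em0|[a aE aF]] := IH (ltnW mn).
  (* Since [E m] is zero, [E m.+1] is concentrated in the degree of [F m]. *)
  have [|EmS0] := pselect (is_zero (E m.+1)); first by left.
  have Fm0 : ~ is_zero (F m).
    by move=> Fm0; apply: EmS0; exact: distinguished_zero (tr _ mn) Em0 Fm0.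
  have [a cFm] := slicing_conc W cP (PF _ mn) Fm0; right; exists a.
    apply: (conc_retract W _ EmS0); apply: conc_distinguished (tr _ mn) _ cFm.
    exact: zero_conc.
  move=> j a' /andP[mj jn] cFj Fj0.
  apply: slicing_order (PF _ mn) (PF _ jn) cFm cFj Fm0 Fj0 _.
  by apply: dphi; rewrite mj.
(* The retraction extends to [E m.+1]: the obstruction is a map from [F m] to the suspension of
   [S a], which lives in degree [a - 1], while [F m] lives above degree [a]. *)
right; exists a; last by move=> j a' /andP[mj jn]; apply: aF; rewrite ltnW.
have [s [r sr]] := aE; have [f [g [h t]]] := tr _ mn.
have [|r' r'E] := distinguished_out_extend (a := r) t.
  have [Fm0|Fm0] := pselect (is_zero (F m)); first exact: zero_source.
  have [a' cFm] := slicing_conc W cP (PF _ mn) Fm0.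
  apply: (conc_hom0 W cFm (conc_susp W (@stalk_conc _ _ a _ _))).
  have aa' : a < a' by apply: (aF m) => //; rewrite leqnn.
  by apply/eqP; lia.
by exists (s ;; f), r'; rewrite -compA -r'E.
Qed.

Lemma no_slicing : False.
Proof.
have [_ _ _ P4] := cP.
have [n [E [F [phi [n0 [E0 En] tr PF dphi]]]]] := P4 _ koszul_neq0.
have [|[a aE _]] := no_slicing_aux E0 tr PF dphi (leqnn n).
  by move=> /(isom_zero En); exact: koszul_neq0.
exact: koszul_no_retract (isom_retract En aE).
Qed.

End Slicing.
End NoSlicing.

(** * The Grothendieck group *)

Section Grothendieck.
Variable T : tricat.

Lemma K0_class_distinguished (X Y Z : T) : is_distinguished X Y Z ->
  K0_class Y = K0_class X + K0_class Z.
Proof.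
move=> t; rewrite /K0_class -raddfD; apply/eqP; rewrite -Quotient.idealrBE.
apply/asboolP => G [_]; apply; exists X, Y, Z; split=> //.
by rewrite opprD addrA.
Qed.

Lemma K0_eq_additive (V : zmodType) (f g : {additive K0 T -> V}) :
  (forall X, f (K0_class X) = g (K0_class X)) -> f =1 g.
Proof.
move=> fg w; rewrite -[w]reprK; move: (repr w) => D.
rewrite -[D]freeg_sumE !raddf_sum; apply: eq_bigr => X _.
by rewrite -[coeff X D]intz -freegU_mulz !raddfMz [_ (\pi _)%qT]fg.
Qed.

Section Lift.
Variable chi : T -> int.
Hypothesis chiD : forall X Y Z, is_distinguished X Y Z -> chi Y = chi X + chi Z.

(** The homomorphism induced by [chi], evaluated on a representative; [int^o] is the group of
    integers as a module over itself, the form that [fglift] takes. *)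
Definition K0_lift (w : K0 T) : int :=
  fglift (chi : {classic T} -> int^o) (repr w).

Let chi_rel (w : free_ab T) : K0_rel w -> fglift (chi : {classic T} -> int^o) w = 0.
Proof.
have fB := lift_is_additive (chi : {classic T} -> int^o).
move=> /(_ [set v | fglift (chi : {classic T} -> int^o) v = 0]); apply; split.
  split=> [|x y /= x0 y0]; first by rewrite /= -[X in fglift _ X](subrr 0) fB subrr.
  by rewrite fB x0 y0 subrr.
move=> _ [X [Y [Z [t ->]]]] /=; rewrite !fB !liftU !scale1r.
by rewrite (chiD t) addrAC addrK subrr.
Qed.

Let K0_liftE (D : free_ab T) :
  K0_lift (\pi_(K0 T) D)%qT = fglift (chi : {classic T} -> int^o) D.
Proof.
have fB := lift_is_additive (chi : {classic T} -> int^o).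
apply/eqP; rewrite -subr_eq0 -fB; apply/eqP/chi_rel/asboolP.
have -> : forall x y : free_ab T, `[< K0_rel (x - y) >] = (x - y \in @K0_relb T) by [].
by rewrite Quotient.idealrBE reprK.
Qed.

Lemma K0_lift_class X : K0_lift (K0_class X) = chi X.
Proof. by rewrite K0_liftE liftU scale1r. Qed.

Lemma K0_lift_is_additive : {morph K0_lift : x y / x - y}.
Proof.
have fB := lift_is_additive (chi : {classic T} -> int^o).
by move=> x y; rewrite -[x]reprK -[y]reprK -raddfB !K0_liftE fB.
Qed.

End Lift.
End Grothendieck.

(** * The Euler characteristic *)

Section EulerCharacteristic.

Definition int_window (N : nat) : seq int :=
  [seq j%:Z - N%:Z | j <- iota 0 N.*2.+1].

Lemma fsbig_window (V : zmodType) (N : nat) (F : int -> V) :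
  (forall i : int, (N < `|i|)%N -> F i = 0) ->
  \sum_(i \in [set: int]) F i = \sum_(i <- int_window N) F i.
Proof.
move=> FN; rewrite (fsbigE (int_window N)) //; last 2 first.
- by rewrite map_inj_uniq ?iota_uniq // => i j; lia.
- move=> i _ iN; apply: FN; rewrite ltnNge; apply: contra iN => iN.
  apply/mapP; exists `|(i + N%:Z)%R|%N; last by lia.
  by rewrite mem_iota; lia.
by apply: eq_bigl => i; rewrite in_setT.
Qed.

Lemma fsbig_int_split (V : zmodType) (F G : int -> V) (N : nat) :
  (forall i : int, (N < `|i|)%N -> F i = 0) ->
  (forall i : int, (N < `|i|)%N -> G i = 0) ->
  \sum_(i \in [set: int]) (F i + G i) =
  \sum_(i \in [set: int]) F i + \sum_(i \in [set: int]) G i.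
Proof.
move=> FN GN; rewrite !(@fsbig_window _ N) ?big_split // => i iN.
by rewrite FN // GN // addr0.
Qed.

Lemma fsbig_int_shift (V : zmodType) (F : int -> V) :
  \sum_(i \in [set: int]) F i = \sum_(i \in [set: int]) F (i + 1).
Proof.
apply: (reindex_fsbigT (fun i : int => i + 1)).
by exists (fun i => i - 1) => i; rewrite ?addrK ?subrK.
Qed.

Definition altsign (i : int) : int := (-1) ^+ `|i|%N.

Lemma altsignS (i : int) : altsign (i + 1) = - altsign i.
Proof.
rewrite /altsign; have [i0|i0] := lerP 0 i.
  have -> : `|(i + 1)%R|%N = `|i|%N.+1 by lia.
  by rewrite exprS mulN1r.
have -> : `|i|%N = `|(i + 1)%R|%N.+1 by lia.
by rewrite exprS mulN1r opprK.
Qed.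

Variables (A : comNzRingType) (k : fieldType) (W : dual_ring A k).
Local Notation rho := (residue W).
Local Notation D := (Dperf A).

(** The rank under [rho] is the rank of the term as a free module over the local ring. *)
Definition euler_term (X : D) (i : int) : int :=
  altsign i * (\rank (map_mx rho (pr X i)))%:Z.

Definition euler (X : D) : int := \sum_(i \in [set: int]) euler_term X i.

Lemma euler_term_bounded (X : D) :
  exists N : nat, forall i : int, (N < `|i|)%N -> euler_term X i = 0.
Proof.
have [N HN] := pcbounded X; exists N => i /HN p0.
by rewrite /euler_term p0 map_mx0 mxrank0 mulr0.
Qed.

Lemma euler_mcone (X Y : D) (u : cmap X Y) : euler (mcone u : D) = euler Y - euler X.
Proof.
have [N XN] := euler_term_bounded X; have [M YM] := euler_term_bounded Y.
have E i : euler_term (mcone u : D) i = euler_term Y i + - euler_term X (i + 1).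
  rewrite /euler_term altsignS /= /cone_pr map_block_mx !map_mx0.
  rewrite rank_diag_block_mx PoszD mulrDr addrC; congr (_ + _).
  by rewrite mulNr opprK.
rewrite /euler; under eq_fsbigr do rewrite E.
rewrite (@fsbig_int_split _ _ _ (N + M).+1); last 2 first.
- by move=> i iN; apply: YM; lia.
- by move=> i iN; rewrite XN ?oppr0 //; lia.
congr (_ + _); rewrite [in RHS](fsbig_int_shift (euler_term X)).
rewrite (@fsbig_window _ (N + M).+1) => [|i iN]; last by rewrite XN ?oppr0 //; lia.
rewrite (@fsbig_window _ (N + M).+1) => [|i iN]; last by rewrite XN //; lia.
by rewrite sumrN.
Qed.

(** A contractible complex becomes exact over [k]: each term has as rank the sum of the ranks of its
    two adjacent differentials, and the alternating sum telescopes. *)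
Lemma euler_zero (X : D) : is_zero X -> euler X = 0.
Proof.
move=> /kmor_eq0[h [_ hd]].
pose r (i : int) : nat := \rank (map_mx rho (df X i)).
(* The homotopy [1 = d h + h d] bounds the rank from above, [d d = 0] from below. *)
have rE (i : int) : \rank (map_mx rho (pr X (i + 1))) = (r (i + 1)%R + r i)%N.
  apply/eqP; rewrite eqn_leq; apply/andP; split.
    rewrite [pr X (i + 1)]hd map_mxD; apply: (leq_trans (mxrank_add _ _)).
    by rewrite !map_mxM leq_add ?mxrankM_maxl ?mxrankM_maxr.
  have := mxrank_mul_ker (map_mx rho (pr X (i + 1))) (map_mx rho (df X (i + 1))).
  rewrite -map_mxM (prdf X) => <-; rewrite leq_add2l; apply: mxrankS.
  rewrite sub_capmx; apply/andP; split.
    by rewrite -{1}(dfpr X) map_mxM submxMl.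
  by apply/sub_kermxP; rewrite -map_mxM (dfdf X) map_mx0.
have [N HN] := pcbounded X.
have r0 (i : int) : (N < `|i|)%N -> r i = 0%N.
  by move=> /HN p0; rewrite /r -(prdf X) p0 mul0mx map_mx0 mxrank0.
rewrite /euler fsbig_int_shift.
have E i : euler_term X (i + 1) = altsign (i + 1) * (r (i + 1))%:Z + - (altsign i * (r i)%:Z).
  by rewrite /euler_term rE PoszD mulrDr {2}altsignS mulNr.
under eq_fsbigr do rewrite E.
pose F i : int := altsign i * (r i)%:Z.
rewrite (@fsbig_int_split _ (fun i => F (i + 1)) (fun i => - F i) N.+1); last 2 first.
- by move=> i iN; rewrite /F r0 ?mulr0 //; lia.
- by move=> i iN; rewrite /F r0 ?mulr0 ?oppr0 //; lia.
rewrite -fsbig_int_shift !(@fsbig_window _ N) ?sumrN ?subrr // => i iN.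
  by rewrite /F r0 ?mulr0 ?oppr0.
by rewrite /F r0 ?mulr0 ?oppr0.
Qed.

(** The cone of an isomorphism is zero. *)
Lemma euler_isom (X Y : D) : isom X Y -> euler X = euler Y.
Proof.
move=> [f]; have [u ->] := kmor_repr f => /mcone_iso_zero/euler_zero.
by rewrite euler_mcone => /eqP; rewrite subr_eq0 => /eqP.
Qed.

Lemma euler_distinguished (X Y Z : D) :
  is_distinguished X Y Z -> euler Y = euler X + euler Z.
Proof.
move=> [f [g [h /distinguishedP[X' [Y' [u [a [b [c [[ia ib ic] _ _ _]]]]]]]]]].
have -> : euler X = euler X' by apply: euler_isom; exists a.
have -> : euler Y = euler Y' by apply: euler_isom; exists b.
have -> : euler Z = euler (mcone u : D) by apply: euler_isom; exists c.
by rewrite euler_mcone addrC subrK.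
Qed.

Lemma euler_stalk n a (p : 'M[A]_n) (pp : p *m p = p) :
  euler (stalk a pp) = altsign a * (\rank (map_mx rho p))%:Z.
Proof.
rewrite /euler (fsbigE [:: a]) //= => [|i _].
  by rewrite big_mkcond big_seq1 in_setT /euler_term /= /at_degree eqxx.
by rewrite inE /euler_term /= /at_degree => /negbTE ->; rewrite map_mx0 mxrank0 mulr0.
Qed.

End EulerCharacteristic.

(** * The co-stability manifold *)

Section ComplexTopology.
Variable R : realType.
Local Notation C := R[i]^o.

(** The norm of [R[i]] takes values in [R[i]], so real estimates are embedded there by [ltcR]. *)
Lemma Re_continuous : continuous (fun z : C => complex.Re z : R).
Proof.
move=> z; have FF : Filter (nbhs (z : C)) := nbhs_filter (z : C).
apply/(@cvgrPdist_lt _ R C (nbhs (z : C)) FF) => e e0.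
have e0' : 0 < (e%:C)%C :> R[i] by rewrite ltcR.
near=> w; rewrite -ltcR -(raddfB (@complex.Re R) z w).
apply: le_lt_trans (normc_ge_Re _) _.
near: w; exact: (@cvgr_dist_lt _ C C (nbhs z) _ id z cvg_id).
Unshelve. all: by end_near. Qed.

Lemma normc_ge_Im (z : R[i]) : (`|complex.Im z|%:C)%C <= `|z|.
Proof.
by rewrite normc_def lecR -sqrtr_sqr ler_wsqrtr // lerDr sqr_ge0.
Qed.

Lemma Im_continuous : continuous (fun z : C => complex.Im z : R).
Proof.
move=> z; have FF : Filter (nbhs (z : C)) := nbhs_filter (z : C).
apply/(@cvgrPdist_lt _ R C (nbhs (z : C)) FF) => e e0.
have e0' : 0 < (e%:C)%C :> R[i] by rewrite ltcR.
near=> w; rewrite -ltcR -(raddfB (@complex.Im R) z w).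
apply: le_lt_trans (normc_ge_Im _) _.
near: w; exact: (@cvgr_dist_lt _ C C (nbhs z) _ id z cvg_id).
Unshelve. all: by end_near. Qed.

Lemma cvg_Complex (T : Type) (F : set_system T) {FF : Filter F} (f g : T -> R)
    (a b : R) : f t @[t --> F] --> a -> g t @[t --> F] --> b ->
  (Complex (f t) (g t) : C) @[t --> F] --> (Complex a b : C).
Proof.
(* A positive element [e] of [R[i]] has imaginary part 0, so it can be halved as a real number. *)
move=> fa gb; apply/cvgrPdist_lt => e; rewrite ltcE => /andP[/eqP /= eI e0].
have eE : e = ((complex.Re e)%:C)%C by case: e eI {e0} => ? ? /= ->.
have e2 : 0 < complex.Re e / 2 by rewrite divr_gt0.
near=> t; rewrite eE normc_def ltcR /=.
apply: le_lt_trans (_ : `|a - f t| + `|b - g t| < _).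
  rewrite -[X in _ <= X]ger0_norm ?addr_ge0 // -sqrtr_sqr ler_wsqrtr //.
  rewrite [X in _ <= X]sqrrD !real_normK ?num_real // addrAC lerDl.
  by rewrite mulrn_wge0 // mulr_ge0.
rewrite [complex.Re e]splitr ltrD //; near: t.
  exact: (cvgr_dist_lt _ _ fa).
exact: (cvgr_dist_lt _ _ gb).
Unshelve. all: by end_near. Qed.

End ComplexTopology.

Lemma int_succ_ind (P : int -> Prop) :
  P 0 -> (forall i, P i <-> P (i + 1)) -> forall i, P i.
Proof.
move=> P0 PS [] m; last rewrite NegzE.
  by elim: m => // m IH; rewrite -addn1 PoszD -PS.
elim: m => [|m IH]; first by rewrite PS addNr.
by rewrite PS; have -> : - m.+2%:Z + 1 = - m.+1%:Z by lia.
Qed.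

(** * Central charges *)

Section Charges.
Variables (R : realType) (A : comNzRingType) (k : fieldType) (W : dual_ring A k).
Local Notation D := (Dperf A).
Local Notation S := (unit_stalk A).
Local Notation C := R[i]^o.
Local Notation rho := (residue W).

Lemma K0_class_isom (X Y : D) : isom X Y -> K0_class X = K0_class Y.
Proof.
move=> XY; have [Z Z0 t] := distinguished_id X.
have t' := distinguished_isom t (isom_refl _) XY (isom_refl _).
by rewrite (K0_class_distinguished t') -(K0_class_distinguished t).
Qed.

Lemma K0_class_zero (X : D) : is_zero X -> K0_class X = 0.
Proof.
move=> X0; have [Z Z0 t] := distinguished_id X.
have := K0_class_distinguished t.
by rewrite -(K0_class_isom (zero_isom X0 Z0)) => /eqP; rewrite addrC -subr_eq subrr eq_sym => /eqP.
Qed.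

Lemma K0_class_susp (X : D) : K0_class (susp X) = - K0_class X.
Proof.
have [Z Z0 t] := distinguished_susp X; apply/eqP; rewrite -addr_eq0 addrC.
by rewrite -(K0_class_distinguished t) (K0_class_zero Z0).
Qed.

Lemma K0_class_unit_stalk (a : int) :
  K0_class (S a) = K0_class (S 0) *~ altsign a.
Proof.
have step b : K0_class (S (b + 1)) = - K0_class (S b).
  rewrite -[LHS]opprK -K0_class_susp; congr (- _).
  by rewrite (K0_class_isom (susp_stalk _ _)) addrK.
elim/int_succ_ind: a => [|a]; first by rewrite mulr1z.
by rewrite step altsignS mulrNz; split=> [->//|/oppr_inj].
Qed.

(** The class of A generates K_0: that of [S a] is the same up to sign, sums of copies follow by
    [conc_ind], and all objects by [stalk_filtration]. *)
Lemma charge_eq (Z Z' : central_charge R D) :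
  Z (K0_class (S 0)) = Z' (K0_class (S 0)) -> Z = Z'.
Proof.
move=> ZS.
pose F : set D := [set X | Z (K0_class X) = Z' (K0_class X)].
have Fiso : iso_closed F by move=> X Y XY; rewrite /F /= (K0_class_isom XY).
have F0 X : is_zero X -> F X by move=> X0; rewrite /F /= (K0_class_zero X0) !raddf0.
have Fext : ext_closed F.
  move=> X Y V t FX FV.
  by rewrite /F /= (K0_class_distinguished t) !raddfD /= FX FV.
have FS a : F (S a) by rewrite /F /= K0_class_unit_stalk !raddfMz ZS.
have Fconc a X : conc a X -> F X.
  move=> cX; apply: (conc_ind W _ _ _ _ cX) => // X1 X2 X3 _ t F1 F2.
  exact: Fext t F1 F2.
have FT X : F X.
  have [n [N [p [pp [E [E0 EN t]]]]]] := stalk_filtration X.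
  apply: (Fiso _ _ EN); elim: (N.*2.+1) => [|i IH]; first exact: F0.
  by apply: Fext (t i) IH _; apply: Fconc (@stalk_conc _ _ (N%:Z - i%:Z) _ _).
have : Z =1 Z' by exact: K0_eq_additive.
case: Z Z' {ZS F Fiso F0 Fext FS Fconc FT} => [f [[f1]]] [g [[g1]]] /= /funext fg.
by move: g1; rewrite -fg => g1; rewrite (Prop_irrelevance f1 g1).
Qed.

Definition std_charge_fun (z : C) (w : K0 D) : C := z *~ K0_lift (euler W) w.

Lemma std_charge_is_additive z : {morph std_charge_fun z : x y / x - y}.
Proof.
move=> x y; rewrite /std_charge_fun.
by rewrite (K0_lift_is_additive (@euler_distinguished _ _ W)) mulrzBr.
Qed.

HB.instance Definition _ z := GRing.isZmodMorphism.Build (K0 D) C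
  (std_charge_fun z) (std_charge_is_additive z).

Definition std_charge (z : C) : central_charge R D := std_charge_fun z.

Lemma std_charge_class z X : std_charge z (K0_class X) = z *~ euler W X.
Proof.
by rewrite /= /std_charge_fun (K0_lift_class (@euler_distinguished _ _ W)).
Qed.

Lemma euler_unit_stalk : euler W (S 0) = 1.
Proof. by rewrite euler_stalk map_mx1 mxrank1 mulr1 /altsign. Qed.

(** The number m exp(i pi b). *)
Definition ray_point (m b : R) : C :=
  Complex (m * cos (pi * b)) (m * sin (pi * b)).

Lemma ray_pointMz (m b : R) (n : int) :
  ray_point m b *~ n = ray_point (m *~ n) b.
Proof.
apply/eqP; rewrite eq_complex /= (raddfMz (@complex.Re R)).
by rewrite (raddfMz (@complex.Im R)) /= !mulrzAl !eqxx.
Qed.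

Lemma ray_point_shift (m b : R) (a : int) :
  ray_point (m *~ altsign a) b = ray_point m (b - a%:~R).
Proof.
elim/int_succ_ind: a => [|a]; first by rewrite subr0.
have N x c : ray_point (- x) c = - ray_point x c.
  by have := ray_pointMz x c (-1); rewrite !mulrN1z.
have E x c : ray_point x (c - 1) = - ray_point x c.
  rewrite -N /ray_point; have -> : pi * c = pi * (c - 1) + pi.
    by rewrite mulrBr mulr1 subrK.
  by rewrite cosDpi sinDpi !mulrNN.
rewrite altsignS mulrNz N intrD opprD addrA E.
by split=> [->//|/oppr_inj].
Qed.

(** A sum of r copies of [S a] has charge (-1)^a r m exp(i pi b), of mass r m and phase [b - a]; r
    is positive for a nonzero object. *)
Lemma std_compatible (m b : R) : 0 < m ->
  compatible (std_charge (ray_point m b)) (std_coslicing (A := A) b).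
Proof.
move=> m0 phi X /(std_coslicingP W)[//|[a -> /(concP W)[n [p [pp Xp]]]]] X0.
have p0 : p != 0.
  apply/eqP => p0; apply: X0; apply: (isom_zero (isom_sym Xp)).
  exact/stalk_zeroP.
have r0 : (0 < \rank (map_mx rho p))%N by rewrite lt0n mxrank_eq0 (idem_rho_neq0 W pp p0).
rewrite std_charge_class (euler_isom W Xp) euler_stalk ray_pointMz (mulrC (altsign a)) mulrzA.
rewrite ray_point_shift; exists (m *~ (\rank (map_mx rho p))%:Z) => //.
by rewrite -pmulrn pmulrn_rgt0.
Qed.

End Charges.

(** * The homeomorphism with the complex numbers *)

Section Homeomorphism.
Variables (R : realType) (A : comNzRingType) (k : fieldType) (W : dual_ring A k).
Local Notation D := (Dperf A).
Local Notation S := (unit_stalk A).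
Local Notation C := R[i]^o.
Local Notation std := (@std_coslice R A k W).

(** If the interval around [b] misses [b'], its hull in [std b'] consists of objects without maps to
    [S 0], which excludes [S 0] itself. Conversely, translation by [b' - b] carries the phases of
    [std b] to those of [std b']. *)
Lemma std_coslice_dist_lt (b b' e : R) :
  (coslice_dist (std b) (std b') < e%:E)%E <-> `|b - b'| < e.
Proof.
split=> [/ereal_inf_lt[_ [e' [e'0 sub] <-]]|be].
  rewrite lte_fin; apply: le_lt_trans.
  rewrite leNgt; apply/negP => e'b.
  have Sb : std b b (S 0).
    apply/(std_coslicingP W); right; exists 0; first by rewrite subr0.
    exact: (@stalk_conc _ _ 0).
  have := sub b _ Sb.
  move=> /(_ [set X | forall f : mor X (S 0), f = 0]) => H.
  apply: (@unit_stalk_neq0 A 0); rewrite /is_zero; apply: (H _ (idm (S 0))) => {H}; split.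
    split=> [X Y Z t X0 Z0 f|X Y Z [i1 [i2 [p1 [p2 [E _ _ _ _]]]]] Z0 f].
      exact: distinguished_hom0 t X0 Z0 f.
    by rewrite -(comp1m f) -E -compA (Z0 (p1 ;; f)) compm0.
  move=> X [psi]; rewrite /= in_itv /= => /andP[psi1 psi2] QX f.
  apply: QX; rewrite subr0 => psib; move: e'b; rewrite ltNge; apply/negP.
  by rewrite negbK ler_distlC -psib psi1 psi2.
have e0 : 0 < e by apply: le_lt_trans be.
(* The infimum must be strictly below [e], hence a radius strictly between the distance and [e]. *)
pose e' := (`|b - b'| + e) / 2.
have be' : `|b - b'| < e' by rewrite midf_lt.
have e'e : e' < e by rewrite midf_lt.
apply: le_lt_trans (_ : (e'%:E < e%:E)%E); last by rewrite lte_fin.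
apply: ereal_inf_lbound; exists e' => //; split.
  by apply: le_lt_trans be'.
move=> phi X QX; apply: sub_gen_smallest.
exists (phi + (b' - b)).
  rewrite /= in_itv /=; move/ltW: be'; rewrite distrC ler_norml => /andP[h1 h2].
  by rewrite lerD2l lerD2l h1.
move=> a pa f; apply: QX => phia; apply: pa.
by rewrite phia addrC addrA subrK.
Qed.

Lemma std_coslice_onto (Q : coslice R D) : exists b, Q = std b.
Proof.
have [b Qb] := coslicing_std W (coslice_is_coslicing Q).
by exists b; exact: coslice_eq.
Qed.

Definition coslice_phase (Q : coslice R D) : R := sval (cid (std_coslice_onto Q)).

Lemma coslice_phaseK (Q : coslice R D) : std (coslice_phase Q) = Q.
Proof. by rewrite /coslice_phase; case: cid. Qed.

Lemma std_coslice_dist_coslice (Q Q' : coslice R D) (e : R) :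
  (coslice_dist Q Q' < e%:E)%E <-> `|coslice_phase Q - coslice_phase Q'| < e.
Proof. by rewrite -std_coslice_dist_lt !coslice_phaseK. Qed.

(** [coslice_phase] comes from a choice; its value at [std b] lies within every positive [e] of [b],
    because the two co-slicings are equal. *)
Lemma std_coslice_phase b : coslice_phase (std b) = b.
Proof.
apply/eqP; rewrite -subr_eq0 -normr_eq0 eq_le normr_ge0 andbT.
apply/ler_addgt0Pr => e e0; rewrite add0r; apply/ltW/std_coslice_dist_lt.
by rewrite coslice_phaseK; apply/std_coslice_dist_lt; rewrite subrr normr0.
Qed.

Lemma coslice_phase_continuous : continuous coslice_phase.
Proof.
move=> Q; apply/(@cvgrPdist_lt _ R _ (nbhs Q) _) => e e0.
rewrite nbhsE; exists [set Q' | `|coslice_phase Q - coslice_phase Q'| < e] => //.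
split; last by rewrite /= subrr normr0.
rewrite -[open _]/(coslice_open _) => Q' /= QQ'.
exists (e - `|coslice_phase Q - coslice_phase Q'|); first by rewrite subr_gt0.
move=> Q'' /std_coslice_dist_coslice lt /=.
apply: le_lt_trans (ler_distD (coslice_phase Q') _ _) _.
by rewrite -ltrBrDl.
Qed.

Lemma std_coslice_continuous : continuous std.
Proof.
move=> b U; rewrite nbhsE => -[V [oV Vb] VU].
have [e e0 He] : exists2 e : R, 0 < e & forall Q' : coslice R D, (coslice_dist (std b) Q' < e%:E)%E -> V Q'.
  by move: oV => /(_ (std b) Vb).
apply: (filterS (P := [set b' | `|b - b'| < e])).
  by move=> b' bb'; apply: VU; apply: He; apply/std_coslice_dist_lt.
exact: (@cvgr_dist_lt _ R _ (nbhs b) _ id b cvg_id).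
Qed.

Definition costab_charge (s : set_type (Costab R D)) : C :=
  ((set_val s).1 : central_charge R D) (K0_class (S 0)).

Definition costab_phase (s : set_type (Costab R D)) : R :=
  coslice_phase (set_val s).2.

(** The argument of [ln] is the real part of Z(A) exp(- i pi b). It is the mass, as Z(A) lies on the
    ray of phase b, and it is continuous in Z(A) and b. *)
Definition costab_coord (s : set_type (Costab R D)) : C :=
  Complex (ln (complex.Re (costab_charge s) * cos (pi * costab_phase s) +
               complex.Im (costab_charge s) * sin (pi * costab_phase s)))
    (costab_phase s).

Definition costab_point (w : C) : central_charge R D * coslice R D :=
  (std_charge W (ray_point (expR (complex.Re w)) (complex.Im w)),
   std (complex.Im w)).

Lemma costab_pointP w : costab_point w \in Costab R D.
Proof. by apply/mem_set/std_compatible; exact: expR_gt0. Qed.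

Definition costab_of_coord (w : C) : set_type (Costab R D) :=
  exist _ (costab_point w) (costab_pointP w).

Lemma ray_point_coord (m b : R) :
  complex.Re (ray_point m b) * cos (pi * b) +
  complex.Im (ray_point m b) * sin (pi * b) = m.
Proof.
by rewrite /= -!mulrA -mulrDr -!expr2 cos2Dsin2 mulr1.
Qed.

Lemma costab_ray (s : set_type (Costab R D)) : exists2 m : R, 0 < m &
  costab_charge s = ray_point m (costab_phase s).
Proof.
rewrite /costab_charge /costab_phase; case: s => [[Z Q] /= sP]; have := set_mem sP; rewrite /Costab /= => cZ.
have [] := cZ (coslice_phase Q) (S 0) _ (@unit_stalk_neq0 A 0).
  have -> : (Q : R -> set D) = std_coslicing (coslice_phase Q).
    by rewrite -{1}(coslice_phaseK Q).
  apply/(std_coslicingP W); right.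
  by exists 0; [rewrite subr0|exact: (@stalk_conc _ _ 0)].
by move=> m m0 mE; exists m.
Qed.

Lemma costab_coordK : cancel costab_coord costab_of_coord.
Proof.
move=> s; have [m m0 mE] := costab_ray s; apply: val_inj.
rewrite /= /costab_point /costab_coord mE ray_point_coord /= coslice_phaseK.
move: mE; rewrite /costab_charge /costab_phase => mE.
rewrite lnK ?posrE // [RHS]surjective_pairing; congr (_, _).
by apply: (charge_eq W); rewrite -mE std_charge_class euler_unit_stalk mulr1z.
Qed.

Lemma costab_of_coordK : cancel costab_of_coord costab_coord.
Proof.
move=> w; rewrite /costab_coord /costab_charge /costab_phase /= std_coslice_phase.
rewrite std_charge_class euler_unit_stalk mulr1z ray_point_coord expRK.
by case: w.
Qed.

Lemma charge_eval_continuous (w : K0 D) :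
  continuous (fun Z : central_charge R D => Z w : C).
Proof.
move=> Z; apply: (cvg_comp (@charge_fun R D) (fun f : {ptws K0 D -> C} => f w)).
  exact: initial_continuous.
exact: (@proj_continuous _ (fun=> C) w).
Qed.

Lemma costab_charge_continuous : continuous costab_charge.
Proof.
move=> s; apply: (cvg_comp (fun t : set_type (Costab R D) => (set_val t).1)
  (fun Z : central_charge R D => Z (K0_class (S 0)) : C)).
  exact: (cvg_comp _ _ (@initial_continuous _ _ set_val s) cvg_fst).
exact: charge_eval_continuous.
Qed.

Lemma costab_phase_continuous : continuous costab_phase.
Proof.
move=> s; apply: (cvg_comp (fun t : set_type (Costab R D) => (set_val t).2)
  coslice_phase); last exact: coslice_phase_continuous.
exact: (cvg_comp _ _ (@initial_continuous _ _ set_val s) cvg_snd).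
Qed.

Lemma costab_coord_continuous : continuous costab_coord.
Proof.
move=> s; have Zc := @costab_charge_continuous s.
have bc := @costab_phase_continuous s.
have pc : pi * costab_phase t @[t --> s] --> pi * costab_phase s by exact: cvgMl_tmp bc.
have FF : Filter (nbhs s) := nbhs_filter s.
apply: (@cvg_Complex R _ (nbhs s) FF) => //.
pose h t := complex.Re (costab_charge t) * cos (pi * costab_phase t) +
  complex.Im (costab_charge t) * sin (pi * costab_phase t).
apply: (cvg_comp h (@ln R) (G := nbhs (h s))); last first.
  (* [ln] is continuous at positive arguments, and here the argument is the mass [m]. *)
  apply: continuous_ln; rewrite /h.
  by have [m m0 ->] := costab_ray s; rewrite ray_point_coord.
apply: cvgD; apply: cvgM.
- exact: (cvg_comp _ _ Zc (@Re_continuous R _)).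
- exact: (cvg_comp _ _ pc (@continuous_cos R _)).
- exact: (cvg_comp _ _ Zc (@Im_continuous R _)).
- exact: (cvg_comp _ _ pc (@continuous_sin R _)).
Qed.

Lemma std_charge_continuous : continuous
  (fun w : C => std_charge W (ray_point (expR (complex.Re w)) (complex.Im w))).
Proof.
(* Charges carry the topology of pointwise convergence, so continuity is checked at each element [x]
   of K_0, where the value is an integer multiple of a [ray_point]. *)
apply: (@continuous_comp_initial _ _ _ (@charge_fun R D)).
set g := _ \o _ => w.
have FF : Filter (g x @[x --> w]) by apply: fmap_filter; exact: nbhs_filter.
apply/(@cvg_sup _ _ _ (g x @[x --> w]) (g w) FF) => x.
apply: (@continuous_comp_initial _ C C (fun f : {ptws K0 D -> C} => f x)) => {FF}w.
have FF : Filter (nbhs w) := nbhs_filter w.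
have -> : (fun f : {ptws K0 D -> C} => f x) \o g = (fun v =>
    ray_point (expR (complex.Re v) *~ K0_lift (euler W) x) (complex.Im v)).
  by apply/funext => v; rewrite -ray_pointMz.
have ic : pi * complex.Im v @[v --> w] --> pi * complex.Im w.
  by apply: (@cvgMl_tmp R _ (nbhs w) FF); exact: Im_continuous.
have rc : expR (complex.Re v) *~ K0_lift (euler W) x @[v --> w] -->
    expR (complex.Re w) *~ K0_lift (euler W) x.
  rewrite -mulrzl (_ : (fun v => _) =
    (fun v : C => (K0_lift (euler W) x)%:~R * expR (complex.Re v))).
    2: by apply/funext => v; rewrite -mulrzl.
  apply: (@cvgMl_tmp R _ (nbhs w) FF); apply: (cvg_comp (fun v : C => complex.Re v) (@expR R)).
    exact: Re_continuous.
  exact: continuous_expR.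
apply: (@cvg_Complex R _ (nbhs w) FF); apply: cvgM => //.
  exact: (cvg_comp _ _ ic (@continuous_cos R _)).
exact: (cvg_comp _ _ ic (@continuous_sin R _)).
Qed.

Lemma costab_of_coord_continuous : continuous costab_of_coord.
Proof.
apply: (@continuous_comp_initial _ _ _ set_val) => w.
have FF : Filter (nbhs w) := nbhs_filter w.
apply: (@cvg_pair C _ _ (nbhs w) _ _ FF (nbhs_filter _) (nbhs_filter _)
  (fun w : C => (costab_point w).1) (fun w : C => (costab_point w).2)).
  exact: std_charge_continuous.
apply: (cvg_comp (fun w : C => complex.Im w) std); first exact: Im_continuous.
exact: std_coslice_continuous.
Qed.

Lemma Costab_homeomorphic : homeomorphic (set_type (Costab R D)) C.
Proof.
exists costab_coord, costab_of_coord; split.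
- exact: costab_coord_continuous.
- exact: costab_of_coord_continuous.
- exact: costab_coordK.
- exact: costab_of_coordK.
Qed.

End Homeomorphism.

(** * The dual numbers *)

Section DualNumbers.
Variable k : fieldType.
Local Notation A := (dual_numbers k).

Definition dual_coef (a : A) (i : nat) : k := (a : {poly k})`_i.

Definition mk_dual (x y : k) : A := in_qpoly 'X^2 (x%:P + y *: 'X).

Let rmodp_X2 (p : {poly k}) : Pdiv.CommonRing.rmodp p (mk_monic 'X^2) = take_poly 2 p.
Proof. by rewrite mk_monic_X2 Pdiv.RingMonic.take_poly_rmodp. Qed.

Lemma dual_ext (a b : A) :
  dual_coef a 0 = dual_coef b 0 -> dual_coef a 1 = dual_coef b 1 -> a = b.
Proof.
move=> ab0 ab1; apply: val_inj; apply/polyP => -[|[|i]] //.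
have small (c : A) : (c : {poly k})`_i.+2 = 0.
  apply: nth_default; rewrite -ltnS.
  apply: leq_trans (size_mk_monic (c : {poly %/ 'X^2})) _.
  by rewrite mk_monic_X2 size_polyXn.
by rewrite !small.
Qed.

Lemma mk_dual_coef x y : dual_coef (mk_dual x y) 0 = x /\ dual_coef (mk_dual x y) 1 = y.
Proof.
rewrite /dual_coef /= rmodp_X2.
by rewrite !coef_take_poly /= !coefD !coefC !coefZ !coefX /= !mulr0 !mulr1 addr0 add0r.
Qed.

Lemma dual_coefM (a b : A) :
  dual_coef (a * b) 0 = dual_coef a 0 * dual_coef b 0 /\
  dual_coef (a * b) 1 = dual_coef a 0 * dual_coef b 1 + dual_coef a 1 * dual_coef b 0.
Proof.
rewrite /dual_coef !poly_of_qpolyM !rmodp_X2.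
by rewrite !coef_take_poly /= !coefM !big_ord_recl !big_ord0 /= !addr0.
Qed.

Lemma dual_coef1 : dual_coef 1 0 = 1 /\ dual_coef 1 1 = 0.
Proof. by rewrite /dual_coef /= !coefC. Qed.

Definition dual_residue (a : A) : k := dual_coef a 0.

Lemma dual_residue_is_additive : {morph dual_residue : a b / a - b}.
Proof. by move=> a b; rewrite /dual_residue /dual_coef -coefB. Qed.

HB.instance Definition _ :=
  GRing.isZmodMorphism.Build A k dual_residue dual_residue_is_additive.

Lemma dual_residue_is_multiplicative : monoid_morphism dual_residue.
Proof. by split=> [|a b]; [exact: dual_coef1.1|exact: (dual_coefM a b).1]. Qed.

HB.instance Definition _ :=
  GRing.isMonoidMorphism.Build A k dual_residue dual_residue_is_multiplicative.

Definition dual_eps : A := mk_dual 0 1.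

(** Multiplication by [dual_eps] moves the constant coefficient to the linear one; the kernel of the
    residue map, the square of [dual_eps] and its annihilator are all read off from this. *)
Let epsE (a : A) : dual_coef (dual_eps * a) 0 = 0 /\
  dual_coef (dual_eps * a) 1 = dual_coef a 0.
Proof.
rewrite (dual_coefM dual_eps a).1 (dual_coefM dual_eps a).2.
by rewrite (mk_dual_coef 0 1).1 (mk_dual_coef 0 1).2 !mul0r mul1r add0r.
Qed.

Lemma dual_unit (a : A) : dual_residue a != 0 -> exists b, a * b = 1.
Proof.
(* The inverse of a0 + a1 X modulo X^2 is 1/a0 - (a1/a0^2) X. *)
move=> a0; exists (mk_dual (dual_coef a 0)^-1 (- (dual_coef a 1 / dual_coef a 0 ^+ 2))).
have [e0 e1] := mk_dual_coef (dual_coef a 0)^-1 (- (dual_coef a 1 / dual_coef a 0 ^+ 2)).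
have [m0 m1] := dual_coefM a (mk_dual (dual_coef a 0)^-1 (- (dual_coef a 1 / dual_coef a 0 ^+ 2))).
have [c0 c1] := dual_coef1; apply: dual_ext.
  by rewrite m0 e0 c0 divff.
rewrite m1 e0 e1 c1 mulrN mulrCA expr2 invfM mulrA mulrA.
by rewrite -(mulrA (dual_coef a 1)) divff // mulr1 addNr.
Qed.

Lemma dual_ker (a : A) : dual_residue a = 0 -> exists b, a = dual_eps * b.
Proof.
move=> a0; exists (mk_dual (dual_coef a 1) 0).
have [e0 e1] := epsE (mk_dual (dual_coef a 1) 0).
by apply: dual_ext; [rewrite e0|rewrite e1 (mk_dual_coef _ _).1].
Qed.

Lemma dual_eps_sq : dual_eps * dual_eps = 0.
Proof.
have [e0 e1] := epsE dual_eps.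
by apply: dual_ext; rewrite ?e0 ?e1 ?(mk_dual_coef _ _).1 /dual_coef coef0.
Qed.

Lemma dual_eps_ann (a : A) : dual_eps * a = 0 -> dual_residue a = 0.
Proof.
by move=> ea; rewrite /dual_residue -(epsE a).2 ea /dual_coef coef0.
Qed.

Definition dual_numbers_dual_ring : dual_ring A k :=
  DualRing dual_unit dual_ker dual_eps_sq dual_eps_ann.

End DualNumbers.

Theorem theoremB (R : realType) (k : closedFieldType) :
  Stab R (Dperf (dual_numbers k)) = set0 /\
  homeomorphic (set_type (Costab R (Dperf (dual_numbers k)))) R[i]^o.
Proof.
split; last exact: Costab_homeomorphic (dual_numbers_dual_ring k).
rewrite -subset0 => s [cP _ _].
exact: (no_slicing (dual_numbers_dual_ring k) cP).
Qed.
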